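(* Let $\mathscr A$ be an abelian category. The following are in bijection: (i) equivalence classes of recollements of abelian categories $\mathsf{R}(\mathscr B,\mathscr A,\mathscr C)$; (ii) strong TTF-triples $(\mathcal X,\mathcal Y,\mathcal Z)$ in $\mathscr A$; (iii) bilocalising TTF-classes $\mathcal Y$ of $\mathscr A$; (iv) bilocalising Serre subcategories $\mathcal Y$ of $\mathscr A$.
   Context: All subcategories are strict (closed under isomorphisms). $\operatorname{Im}F$ denotes the essential image of a functor $F$ and $\operatorname{Ker}F$ the full subcategory of objects sent to zero. A recollement $\mathsf{R}(\mathscr B,\mathscr A,\mathscr C)$ of an abelian category $\mathscr A$ by abelian categories $\mathscr B$ and $\mathscr C$ consists of additive functors $i_*\colon\mathscr B\to\mathscr A$, $i^*,i^!\colon\mathscr A\to\mathscr B$, $j^*\colon\mathscr A\to\mathscr C$, $j_!,j_*\colon\mathscr C\to\mathscr A$ such that: (1) $(j_!,j^*,j_* )$ and $(i^*,i_*,i^!)$ are adjoint triples (each functor is left adjoint to the next); (2) $i_*$, $j_!$ and $j_*$ are fully faithful; (3) $\operatorname{Im} i_*=\operatorname{Ker} j^*$. Two recollements $\mathsf{R}(\mathscr B,\mathscr A,\mathscr C)$ and $\mathsf{R}(\mathscr B',\mathscr A',\mathscr C')$ are equivalent if there are equivalences of categories $\Phi\colon\mathscr A\to\mathscr A'$ and $\Theta\colon\mathscr C\to\mathscr C'$ such that $\Theta j^*$ is naturally equivalent to $j^{*\prime}\Phi$, where $j^{*\prime}\colon\mathscr A'\to\mathscr C'$ is the functor of the second recollement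 corresponding to $j^*$. A torsion pair in $\mathscr A$ is a pair $(\mathcal T,\mathcal F)$ of full subcategories such that $\operatorname{Hom}_{\mathscr A}(T,F)=0$ for all $T\in\mathcal T$, $F\in\mathcal F$, and every object $M$ of $\mathscr A$ admits a short exact sequence $0\to T_M\to M\to F^M\to 0$ with $T_M\in\mathcal T$, $F^M\in\mathcal F$. A TTF-triple is a triple $(\mathcal X,\mathcal Y,\mathcal Z)$ of full subcategories such that $(\mathcal X,\mathcal Y)$ and $(\mathcal Y,\mathcal Z)$ are torsion pairs; then $\mathcal Y$ is called a TTF-class. A torsion pair $(\mathcal T,\mathcal F)$ is strongly hereditary if there are a functor $\mathsf L\colon\mathscr A\to\mathscr A$ and a natural transformation $\phi\colon\mathrm{Id}_{\mathscr A}\to\mathsf L$ such that for all $M\in\mathscr A$: $\operatorname{Ker}\phi_M,\operatorname{Coker}\phi_M\in\mathcal T$; $\mathsf L(M)\in\mathcal F$; and $\mathsf L(M)$ is $\mathcal T$-divisible, i.e. $\operatorname{Hom}_{\mathscr A}(-,\mathsf L(M))$ is exact on short exact sequences $0\to K\to M'\to N\to0$ with $N\in\mathcal T$. It is strongly cohereditary if there are a functor $\mathsf C\colon\mathscr A\to\mathscr A$ and a natural transformation $\psi\colon\mathsf C\to\mathrm{Id}_{\mathscr A}$ such that for all $M\in\mathscr A$: $\operatorname{Ker}\psi_M,\operatorname{Coker}\psi_M\in\mathcal F$; $\mathsf C(M)\in\mathcal T$; and $\mathsf C(M)$ is $\mathcal F$-codivisible, i.e. $\operatorname{Hom}_{\mathscr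 A}(\mathsf C(M),-)$ is exact on short exact sequences $0\to K\to M'\to N\to0$ with $K\in\mathcal F$. A TTF-triple $(\mathcal X,\mathcal Y,\mathcal Z)$ is strong if $(\mathcal X,\mathcal Y)$ is strongly cohereditary and $(\mathcal Y,\mathcal Z)$ is strongly hereditary. A Serre subcategory $\mathcal Y$ of $\mathscr A$ is a full subcategory closed under subobjects, quotients and extensions; it yields the Gabriel quotient functor $\mathscr A\to\mathscr A/\mathcal Y$. A Serre subcategory is bilocalising if this quotient functor admits both a left and a right adjoint. Every TTF-class is a Serre subcategory.
   Formalization: Recollements of the fixed category A are compared only with Φ = Id_A; with arbitrary self-equivalences Φ the claim fails: for A = mod k × mod k the swap leaves three equivalence classes of recollements but four bilocalising Serre subcategories. *)

(* Defs.v *)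
From mathcomp Require Import all_boot all_algebra.

Set Implicit Arguments.
Unset Strict Implicit.
Unset Printing Implicit Defensive.

Import GRing.Theory.
Local Open Scope ring_scope.

Declare Scope cat_scope.
Delimit Scope cat_scope with cat.
Local Open Scope cat_scope.

Record preadditive_category := PreadditiveCategory {
  obj :> Type;
  hom : obj -> obj -> zmodType;
  idm : forall a, hom a a;
  compm : forall a b c, hom b c -> hom a b -> hom a c;
  compmA : forall a b c d (h : hom c d) (g : hom b c) (f : hom a b),
    compm h (compm g f) = compm (compm h g) f;
  comp1m : forall a b (f : hom a b), compm (idm b) f = f;
  compm1 : forall a b (f : hom a b), compm f (idm a) = f;
  compmDl : forall a b c (g g' : hom b c) (f : hom a b),
    compm (g + g') f = compm g f + compm g' f;
  compmDr : forall a b c (g : hom b c) (f f' : hom a b),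
    compm g (f + f') = compm g f + compm g f'
}.

Arguments hom {_} _ _.
Arguments idm {_} _.
Arguments compm {_ _ _ _} _ _.

(* [g ∘ f] is [g] after [f]. *)
Notation "g ∘ f" := (compm g f) (at level 40, left associativity) : cat_scope.

Section Morphisms.
Variable C : preadditive_category.
Implicit Types a b c x : C.

Definition is_zero x : Prop :=
  forall a, (forall f : hom x a, f = 0) /\ (forall f : hom a x, f = 0).

Definition monic a b (f : hom a b) : Prop :=
  forall x (u v : hom x a), f ∘ u = f ∘ v -> u = v.

Definition epic a b (f : hom a b) : Prop :=
  forall x (u v : hom b x), u ∘ f = v ∘ f -> u = v.

Definition is_iso a b (f : hom a b) : Prop :=
  exists g : hom b a, g ∘ f = idm a /\ f ∘ g = idm b.

Definition isomorphic a b : Prop := exists f : hom a b, is_iso f.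

Definition is_kernel a b (f : hom a b) k (i : hom k a) : Prop :=
  f ∘ i = 0 /\
  forall x (u : hom x a), f ∘ u = 0 -> exists! v : hom x k, i ∘ v = u.

Definition is_cokernel a b (f : hom a b) q (p : hom b q) : Prop :=
  p ∘ f = 0 /\
  forall x (u : hom b x), u ∘ f = 0 -> exists! v : hom q x, v ∘ p = u.

Definition is_biproduct a b s (i1 : hom a s) (i2 : hom b s)
    (p1 : hom s a) (p2 : hom s b) : Prop :=
  [/\ p1 ∘ i1 = idm a, p2 ∘ i2 = idm b, p1 ∘ i2 = 0, p2 ∘ i1 = 0 &
      i1 ∘ p1 + i2 ∘ p2 = idm s].

(* 0 -> k -> m -> n -> 0 *)
Definition short_exact k m n (i : hom k m) (p : hom m n) : Prop :=
  is_kernel p i /\ is_cokernel i p.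

End Morphisms.

Record is_abelian (C : preadditive_category) : Prop := IsAbelian {
  abelian_zero : exists z : C, is_zero z;
  abelian_biproduct : forall a b : C, exists (s : C) (i1 : hom a s)
    (i2 : hom b s) (p1 : hom s a) (p2 : hom s b), is_biproduct i1 i2 p1 p2;
  abelian_kernel : forall (a b : C) (f : hom a b),
    exists (k : C) (i : hom k a), is_kernel f i;
  abelian_cokernel : forall (a b : C) (f : hom a b),
    exists (q : C) (p : hom b q), is_cokernel f p;
  abelian_monic : forall (a b : C) (f : hom a b), monic f ->
    exists (c : C) (g : hom b c), is_kernel g f;
  abelian_epic : forall (a b : C) (f : hom a b), epic f ->
    exists (c : C) (g : hom c a), is_cokernel g f
}.

Record abelian_category := AbelianCategory {
  abelian_cat :> preadditive_category;
  abelianP : is_abelian abelian_cat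
}.

Record functor (C D : preadditive_category) := Functor {
  fobj :> C -> D;
  fmap : forall a b : C, hom a b -> hom (fobj a) (fobj b);
  fmap1 : forall a : C, fmap (idm a) = idm (fobj a);
  fmap_comp : forall (a b c : C) (g : hom b c) (f : hom a b),
    fmap (g ∘ f) = fmap g ∘ fmap f
}.

Arguments fmap {_ _} _ {_ _} _.

Definition id_functor (C : preadditive_category) : functor C C :=
  @Functor C C (fun a => a) (fun a b f => f) (fun a => erefl)
    (fun a b c g f => erefl).

Section CompFunctor.
Variables (C D E : preadditive_category) (G : functor D E) (F : functor C D).

Let comp_map (a b : C) (f : hom a b) : hom (G (F a)) (G (F b)) :=
  fmap G (fmap F f).

Fact comp_functor_id (a : C) : comp_map (idm a) = idm (G (F a)).
Proof. by rewrite /comp_map !fmap1. Qed.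

Fact comp_functor_comp (a b c : C) (g : hom b c) (f : hom a b) :
  comp_map (g ∘ f) = comp_map g ∘ comp_map f.
Proof. by rewrite /comp_map !fmap_comp. Qed.

Definition comp_functor : functor C E :=
  Functor comp_functor_id comp_functor_comp.

End CompFunctor.

Record nat_trans (C D : preadditive_category) (F G : functor C D) := NatTrans {
  nt_app :> forall a : C, hom (F a) (G a);
  nt_natural : forall (a b : C) (f : hom a b),
    nt_app b ∘ fmap F f = fmap G f ∘ nt_app a
}.

Definition nat_iso (C D : preadditive_category) (F G : functor C D) : Prop :=
  exists t : nat_trans F G, forall a, is_iso (t a).

Definition is_equivalence (C D : preadditive_category) (F : functor C D) : Prop :=
  exists G : functor D C,
    nat_iso (comp_functor G F) (id_functor C) /\
    nat_iso (comp_functor F G) (id_functor D).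

(* [L] is left adjoint to [R]. *)
Definition adjoint (C D : preadditive_category)
    (L : functor C D) (R : functor D C) : Prop :=
  exists (eta : nat_trans (id_functor C) (comp_functor R L))
         (eps : nat_trans (comp_functor L R) (id_functor D)),
    (forall c : C, eps (L c) ∘ fmap L (eta c) = idm (L c)) /\
    (forall d : D, fmap R (eps d) ∘ eta (R d) = idm (R d)).

Section FunctorProperties.
Variables (C D : preadditive_category) (F : functor C D).

Definition additive_functor : Prop :=
  forall (a b : C) (f g : hom a b), fmap F (f + g) = fmap F f + fmap F g.

Definition exact_functor : Prop :=
  additive_functor /\
  forall (k m n : C) (i : hom k m) (p : hom m n),
    short_exact i p -> short_exact (fmap F i) (fmap F p).

Definition fully_faithful : Prop :=
  forall a b : C, bijective (fun f : hom a b => fmap F f).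

Definition ess_image (d : D) : Prop := exists c : C, isomorphic (F c) d.

Definition functor_ker (c : C) : Prop := is_zero (F c).

End FunctorProperties.

Record recollement (A : abelian_category) := Recollement {
  rec_B : abelian_category;
  rec_C : abelian_category;
  i_lstar : functor rec_B A;    (* i_* *)
  i_ustar : functor A rec_B;    (* i^* *)
  i_ushriek : functor A rec_B;  (* i^! *)
  j_ustar : functor A rec_C;    (* j^* *)
  j_lshriek : functor rec_C A;  (* j_! *)
  j_lstar : functor rec_C A;    (* j_* *)
  rec_additive_i : [/\ additive_functor i_lstar, additive_functor i_ustar &
                       additive_functor i_ushriek];
  rec_additive_j : [/\ additive_functor j_ustar, additive_functor j_lshriek &
                       additive_functor j_lstar];
  rec_adjoint_j : adjoint j_lshriek j_ustar /\ adjoint j_ustar j_lstar;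
  rec_adjoint_i : adjoint i_ustar i_lstar /\ adjoint i_lstar i_ushriek;
  rec_fully_faithful : [/\ fully_faithful i_lstar, fully_faithful j_lshriek &
                           fully_faithful j_lstar];
  rec_im_ker : forall M : A, ess_image i_lstar M <-> functor_ker j_ustar M
}.

Definition equivalent_recollements_along (A A' : abelian_category)
    (Phi : functor A A') (R : recollement A) (R' : recollement A') : Prop :=
  is_equivalence Phi /\
  exists Theta : functor (rec_C R) (rec_C R'),
    is_equivalence Theta /\
    nat_iso (comp_functor Theta (j_ustar R)) (comp_functor (j_ustar R') Phi).

(* Recollements of one fixed category [A] are compared along [Id_A].  If [Phi]
   could be any self-equivalence of [A], the classes would only see TTF-triples
   up to self-equivalence: for [A = mod k * mod k] the swap would identify the
   recollements whose [B] are the two factors, although the factors are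
   distinct Serre subcategories. *)
Definition equivalent_recollements (A : abelian_category)
    (R R' : recollement A) : Prop :=
  equivalent_recollements_along (id_functor A) R R'.

Record recollement_class (A : abelian_category) := RecollementClass {
  in_recollement_class :> recollement A -> Prop;
  recollement_classP :
    exists R, in_recollement_class = equivalent_recollements R
}.

Definition class_of_recollement (A : abelian_category) (R : recollement A) :
    recollement_class A :=
  RecollementClass (ex_intro _ R (erefl (equivalent_recollements R))).

Record subcategory (C : preadditive_category) := Subcategory {
  in_subcategory :> C -> Prop;
  subcategory_strict : forall a b : C,
    isomorphic a b -> in_subcategory a -> in_subcategory b
}.

Section Torsion.
Variable A : abelian_category.
Implicit Types T F X Y Z : subcategory A.

Definition torsion_pair T F : Prop :=
  (forall t f : A, T t -> F f -> forall u : hom t f, u = 0) /\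
  (forall M : A, exists (t f : A) (i : hom t M) (p : hom M f),
     [/\ T t, F f & short_exact i p]).

Definition ttf_triple X Y Z : Prop := torsion_pair X Y /\ torsion_pair Y Z.

Definition ttf_class Y : Prop := exists X Z, ttf_triple X Y Z.

(* 0 -> Hom(N,D) -> Hom(M,D) -> Hom(K,D) -> 0 is exact for every short exact
   sequence 0 -> K -> M -> N -> 0 with N in T. *)
Definition divisible T (D : A) : Prop :=
  forall (K M N : A) (i : hom K M) (p : hom M N), short_exact i p -> T N ->
  [/\ forall u v : hom N D, u ∘ p = v ∘ p -> u = v,
      forall u : hom M D, u ∘ i = 0 <-> exists v : hom N D, v ∘ p = u &
      forall w : hom K D, exists u : hom M D, u ∘ i = w].

(* 0 -> Hom(D,K) -> Hom(D,M) -> Hom(D,N) -> 0 is exact for every short exact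
   sequence 0 -> K -> M -> N -> 0 with K in F. *)
Definition codivisible F (D : A) : Prop :=
  forall (K M N : A) (i : hom K M) (p : hom M N), short_exact i p -> F K ->
  [/\ forall u v : hom D K, i ∘ u = i ∘ v -> u = v,
      forall u : hom D M, p ∘ u = 0 <-> exists v : hom D K, i ∘ v = u &
      forall w : hom D N, exists u : hom D M, p ∘ u = w].

Definition ker_in T (a b : A) (f : hom a b) : Prop :=
  forall (k : A) (i : hom k a), is_kernel f i -> T k.

Definition coker_in T (a b : A) (f : hom a b) : Prop :=
  forall (q : A) (p : hom b q), is_cokernel f p -> T q.

Definition strongly_hereditary T F : Prop :=
  torsion_pair T F /\
  exists (L : functor A A) (phi : nat_trans (id_functor A) L),
    forall M : A, [/\ ker_in T (phi M), coker_in T (phi M), F (L M) &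
                      divisible T (L M)].

Definition strongly_cohereditary T F : Prop :=
  torsion_pair T F /\
  exists (C : functor A A) (psi : nat_trans C (id_functor A)),
    forall M : A, [/\ ker_in F (psi M), coker_in F (psi M), T (C M) &
                      codivisible F (C M)].

Definition strong_ttf X Y Z : Prop :=
  [/\ ttf_triple X Y Z, strongly_cohereditary X Y & strongly_hereditary Y Z].

(* The clause on zero objects excludes the empty subcategory. *)
Definition serre Y : Prop :=
  [/\ forall z : A, is_zero z -> Y z,
      forall (a b : A) (f : hom a b), monic f -> Y b -> Y a,
      forall (a b : A) (f : hom a b), epic f -> Y a -> Y b &
      forall (k m n : A) (i : hom k m) (p : hom m n),
        short_exact i p -> Y k -> Y n -> Y m].

End Torsion.

Section GabrielQuotient.
Variables (A : abelian_category) (Y : subcategory A).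

Definition large_sub (M M' : A) (m : hom M' M) : Prop :=
  monic m /\ coker_in Y m.

Definition small_quot (N N' : A) (n : hom N N') : Prop :=
  epic n /\ ker_in Y n.

(* Gabriel's definition is
     Hom_{A/Y}(M, N) = colim Hom_A(M', N / N0)
   over the subobjects M' of M with M / M' in Y and the subobjects N0 of N
   lying in Y.  A [fraction M N] is an element of one of the groups of this
   directed system, N / N0 being given by the epimorphism [frac_out]. *)
Record fraction (M N : A) := Fraction {
  frac_src : A;
  frac_tgt : A;
  frac_in : hom frac_src M;
  frac_out : hom N frac_tgt;
  frac_in_large : large_sub frac_in;
  frac_out_small : small_quot frac_out;
  frac_map :> hom frac_src frac_tgt
}.

(* Two elements have the same class in the colimit when they have the same
   image at a common later stage. *)
Definition fraction_eqv (M N : A) (s t : fraction M N) : Prop :=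
  exists (M1 N1 : A) (a : hom M1 (frac_src s)) (a' : hom M1 (frac_src t))
         (b : hom (frac_tgt s) N1) (b' : hom (frac_tgt t) N1),
    [/\ frac_in s ∘ a = frac_in t ∘ a', large_sub (frac_in s ∘ a),
        b ∘ frac_out s = b' ∘ frac_out t, small_quot (b ∘ frac_out s) &
        b ∘ s ∘ a = b' ∘ t ∘ a'].

(* [g = Q(frac_out)^-1 Q(s) Q(frac_in)^-1] *)
Definition represents (D : abelian_category) (Q : functor A D) (M N : A)
    (s : fraction M N) (g : hom (Q M) (Q N)) : Prop :=
  fmap Q (frac_out s) ∘ g ∘ fmap Q (frac_in s) = fmap Q s.

(* [Q : A -> D] is the quotient functor A -> A/Y, up to an equivalence on D:
   it is exact, kills Y, is essentially surjective, and
   Hom_D(Q M, Q N) is the above colimit through [represents]. *)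
Definition gabriel_quotient (D : abelian_category) (Q : functor A D) : Prop :=
  [/\ exact_functor Q,
      forall M : A, Y M -> is_zero (Q M),
      forall d : D, ess_image Q d,
      forall (M N : A) (g : hom (Q M) (Q N)),
        exists s : fraction M N, represents s g &
      forall (M N : A) (s t : fraction M N) (g : hom (Q M) (Q N)),
        represents s g -> (represents t g <-> fraction_eqv s t)].

Definition bilocalising : Prop :=
  exists (D : abelian_category) (Q : functor A D),
    [/\ gabriel_quotient Q,
        exists L : functor D A, adjoint L Q &
        exists R : functor D A, adjoint Q R].

End GabrielQuotient.

Record strong_ttf_triple (A : abelian_category) := StrongTTFTriple {
  ttf_X : subcategory A;
  ttf_Y : subcategory A;
  ttf_Z : subcategory A;
  strong_ttf_tripleP : strong_ttf ttf_X ttf_Y ttf_Z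
}.

Record bilocalising_ttf_class (A : abelian_category) := BilocalisingTTFClass {
  bttf_Y :> subcategory A;
  bttfP : ttf_class bttf_Y /\ bilocalising bttf_Y
}.

Record bilocalising_serre (A : abelian_category) := BilocalisingSerre {
  bserre_Y :> subcategory A;
  bserreP : serre bserre_Y /\ bilocalising bserre_Y
}.

(* Main.v *)
From mathcomp Require Import all_boot all_algebra.
From mathcomp Require Import boolp.
Require Import Defs.

(* All four collections inject into the strict subcategories of A, by sending
   a recollement to Ker j^* and a TTF-triple to its middle term, and the proof
   consists in showing that the four images coincide with the subcategories
   Y = Ker Q, where Q has a left adjoint and a fully faithful right adjoint R.
   - Such a Q is exact.  The unit M -> R Q M has kernel and cokernel in Y, so it
     provides the torsion pair (Y, Y^perp), shows that it is strongly
     hereditary, and turns maps in the target of Q into Gabriel fractions.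
     Opposite categories give the other half of the TTF-triple.
   - From a strong TTF-triple, Q is the reflection onto the full subcategory of
     Y-closed objects (those orthogonal to the maps with kernel and cokernel in
     Y).  For Y-coclosed C and Y-closed N both Hom(C, -) and Hom(-, N) invert
     these maps, so the coreflection C(d) -> d of a closed object d makes
     d |-> C(d) left adjoint to Q; this also yields the exactness of Q for
     free.
   - A recollement is determined up to equivalence by Ker j^*: if
     Ker j^* = Ker j'^*, then j'^* j_* is an equivalence. *)

Set Implicit Arguments.
Unset Strict Implicit.
Unset Printing Implicit Defensive.

Import GRing.Theory.
Local Open Scope ring_scope.
Local Open Scope cat_scope.

(** * Preadditive categories: zero objects, isomorphisms, kernels and cokernels *)

Section Preadditive.
Variable C : preadditive_category.
Implicit Types a b c x k q : C.

Lemma compm0 a b c (g : hom b c) : g ∘ (0 : hom a b) = 0.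
Proof. by apply: (addIr (g ∘ 0)); rewrite -compmDr !add0r. Qed.

Lemma comp0m a b c (f : hom a b) : (0 : hom b c) ∘ f = 0.
Proof. by apply: (addIr (0 ∘ f)); rewrite -compmDl !add0r. Qed.

Lemma compmN a b c (g : hom b c) (f : hom a b) : g ∘ (- f) = - (g ∘ f).
Proof. by apply: (addIr (g ∘ f)); rewrite -compmDr !addNr compm0. Qed.

Lemma compNm a b c (g : hom b c) (f : hom a b) : (- g) ∘ f = - (g ∘ f).
Proof. by apply: (addIr (g ∘ f)); rewrite -compmDl !addNr comp0m. Qed.

Lemma compmBr a b c (g : hom b c) (f f' : hom a b) :
  g ∘ (f - f') = g ∘ f - g ∘ f'.
Proof. by rewrite compmDr compmN. Qed.

Lemma compmBl a b c (g g' : hom b c) (f : hom a b) :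
  (g - g') ∘ f = g ∘ f - g' ∘ f.
Proof. by rewrite compmDl compNm. Qed.

Lemma monicP a b (f : hom a b) :
  (forall x (u : hom x a), f ∘ u = 0 -> u = 0) -> monic f.
Proof.
move=> H x u v E; apply/eqP; rewrite -subr_eq0; apply/eqP; apply: H.
by rewrite compmBr E subrr.
Qed.

Lemma monic0 a b (f : hom a b) x (u : hom x a) : monic f -> f ∘ u = 0 -> u = 0.
Proof. by move=> mf fu; apply: mf; rewrite fu compm0. Qed.

Lemma epicP a b (f : hom a b) :
  (forall x (u : hom b x), u ∘ f = 0 -> u = 0) -> epic f.
Proof.
move=> H x u v E; apply/eqP; rewrite -subr_eq0; apply/eqP; apply: H.
by rewrite compmBl E subrr.
Qed.

Lemma epic0 a b (f : hom a b) x (u : hom b x) : epic f -> u ∘ f = 0 -> u = 0.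
Proof. by move=> mf fu; apply: mf; rewrite fu comp0m. Qed.

Lemma is_zeroP a : idm a = 0 -> is_zero a.
Proof.
move=> E b; split=> f; first by rewrite -[f]compm1 E compm0.
by rewrite -[f]comp1m E comp0m.
Qed.

Lemma zero_idm a : is_zero a -> idm a = 0.
Proof. by move=> Z; apply: (Z a).1. Qed.

Lemma zero_to a b (f : hom a b) : is_zero b -> f = 0.
Proof. by move=> Z; apply: (Z a).2. Qed.

Lemma zero_from a b (f : hom a b) : is_zero a -> f = 0.
Proof. by move=> Z; apply: (Z b).1. Qed.

Lemma iso_idm a : is_iso (idm a).
Proof. by exists (idm a); rewrite comp1m. Qed.

Lemma iso_comp a b c (g : hom b c) (f : hom a b) :
  is_iso g -> is_iso f -> is_iso (g ∘ f).
Proof.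
move=> [g' [g'g gg']] [f' [f'f ff']]; exists (f' ∘ g'); split.
  by rewrite -compmA (compmA g') g'g comp1m.
by rewrite -compmA (compmA f) ff' comp1m.
Qed.

Lemma iso_monic a b (f : hom a b) : is_iso f -> monic f.
Proof.
by move=> [g [gf _]] x u v E; rewrite -[u]comp1m -[v]comp1m -gf -!compmA E.
Qed.

Lemma iso_epic a b (f : hom a b) : is_iso f -> epic f.
Proof.
by move=> [g [_ fg]] x u v E; rewrite -[u]compm1 -[v]compm1 -fg !compmA E.
Qed.

Lemma split_epic_monic_iso a b (f : hom a b) (s : hom b a) :
  monic f -> f ∘ s = idm b -> is_iso f.
Proof.
move=> mf fs; exists s; split=> //; apply: mf.
by rewrite compmA fs comp1m compm1.
Qed.

Lemma iso_compl a b c (g : hom b c) (f : hom a b) :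
  is_iso g -> is_iso (g ∘ f) -> is_iso f.
Proof.
move=> ig [h [hgf gfh]]; exists (h ∘ g); split; first by rewrite -compmA.
by apply: (iso_monic ig); rewrite !compmA gfh comp1m compm1.
Qed.

Lemma iso_compr a b c (g : hom b c) (f : hom a b) :
  is_iso f -> is_iso (g ∘ f) -> is_iso g.
Proof.
move=> ig [h [hgf gfh]]; exists (f ∘ h); split; last by rewrite compmA.
by apply: (iso_epic ig); rewrite -!compmA hgf comp1m compm1.
Qed.

Lemma iso_sym a b : isomorphic a b -> isomorphic b a.
Proof. by move=> [f [g [gf fg]]]; exists g, f. Qed.

Lemma iso_zero a b : isomorphic a b -> is_zero a -> is_zero b.
Proof.
by move=> [f [g [gf fg]]] Z; apply: is_zeroP; rewrite -fg (zero_to g Z) compm0.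
Qed.

Lemma kernel_monic a b (f : hom a b) k (i : hom k a) : is_kernel f i -> monic i.
Proof.
move=> [fi K] x u v E.
have [|w [_ wu]] := K x (i ∘ u); first by rewrite compmA fi comp0m.
by rewrite -(wu u) // -(wu v).
Qed.

Lemma cokernel_epic a b (f : hom a b) q (p : hom b q) :
  is_cokernel f p -> epic p.
Proof.
move=> [fi K] x u v E.
have [|w [_ wu]] := K x (u ∘ p); first by rewrite -compmA fi compm0.
by rewrite -(wu u) // -(wu v).
Qed.

Lemma kernel_lift a b (f : hom a b) k (i : hom k a) x (u : hom x a) :
  is_kernel f i -> f ∘ u = 0 -> exists v, i ∘ v = u.
Proof. by move=> [_ K] /K[v [E _]]; exists v. Qed.

Lemma cokernel_lift a b (f : hom a b) q (p : hom b q) x (u : hom b x) :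
  is_cokernel f p -> u ∘ f = 0 -> exists v, v ∘ p = u.
Proof. by move=> [_ K] /K[v [E _]]; exists v. Qed.

Lemma kernelP a b (f : hom a b) k (i : hom k a) :
  monic i -> f ∘ i = 0 ->
  (forall x (u : hom x a), f ∘ u = 0 -> exists v, i ∘ v = u) -> is_kernel f i.
Proof.
move=> mi fi H; split=> // x u /H[v iv]; exists v; split=> // w iw.
by apply: mi; rewrite iv iw.
Qed.

Lemma cokernelP a b (f : hom a b) q (p : hom b q) :
  epic p -> p ∘ f = 0 ->
  (forall x (u : hom b x), u ∘ f = 0 -> exists v, v ∘ p = u) -> is_cokernel f p.
Proof.
move=> mi fi H; split=> // x u /H[v iv]; exists v; split=> // w iw.
by apply: mi; rewrite iv iw.
Qed.

Lemma kernel_unique a b (f : hom a b) k (i : hom k a) k' (i' : hom k' a) :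
  is_kernel f i -> is_kernel f i' -> isomorphic k k'.
Proof.
move=> K K'; have [u iu] := kernel_lift K' K.1.
have [v iv] := kernel_lift K K'.1.
exists u, v; split.
  by apply: (kernel_monic K); rewrite compmA iv iu compm1.
by apply: (kernel_monic K'); rewrite compmA iu iv compm1.
Qed.

Lemma kernel_monic_comp a b c (f : hom a b) (m : hom b c) k (i : hom k a) :
  monic m -> is_kernel f i <-> is_kernel (m ∘ f) i.
Proof.
move=> mm; split=> K; apply: (kernelP (kernel_monic K)).
- by rewrite -compmA K.1 compm0.
- by move=> x u; rewrite -compmA => /(monic0 mm); apply: kernel_lift.
- by apply: (monic0 mm); rewrite compmA K.1.
- by move=> x u fu; apply: (kernel_lift K); rewrite -compmA fu compm0.
Qed.

Lemma monic_kernel_zero a b (f : hom a b) k (i : hom k a) :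
  monic f -> is_kernel f i -> is_zero k.
Proof.
move=> mf K; apply: is_zeroP; apply: (kernel_monic K).
by rewrite compm0 compm1; apply: (monic0 mf); rewrite K.1.
Qed.

Lemma kernel_zero_monic a b (f : hom a b) k (i : hom k a) :
  is_kernel f i -> is_zero k -> monic f.
Proof.
move=> K Z; apply: monicP => x u /(kernel_lift K)[v <-].
by rewrite (zero_to v Z) compm0.
Qed.

Lemma monic_comp a b c (g : hom b c) (f : hom a b) :
  monic g -> monic f -> monic (g ∘ f).
Proof. by move=> mg mf x u v; rewrite -!compmA => /mg/mf. Qed.

Lemma monic_compr a b c (g : hom b c) (f : hom a b) : monic (g ∘ f) -> monic f.
Proof. by move=> m x u v E; apply: m; rewrite -!compmA E. Qed.

End Preadditive.

(** * Opposite categories and duality *)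

Section Opposite.
Variable C : preadditive_category.

(** Objects, morphisms and composition reduce to those of [C], so that [is_kernel] in [op_cat C] is
    [is_cokernel] in [C] by conversion. A lemma applied to [op_cat C] thereby proves its dual. *)
Definition op_cat : preadditive_category :=
  @PreadditiveCategory C (fun a b => @hom C b a) (fun a => @idm C a)
    (fun a b c g f => f ∘ g)
    (fun a b c d h g f => esym (compmA f g h))
    (fun a b f => compm1 f) (fun a b f => comp1m f)
    (fun a b c g g' f => compmDr f g g') (fun a b c g f f' => compmDl f f' g).

Lemma op_is_zero (x : C) : is_zero x -> @is_zero op_cat x.
Proof. by move=> Z a; have [] := Z a. Qed.

Lemma unop_is_zero (x : C) : @is_zero op_cat x -> is_zero x.
Proof. by move=> Z a; have [] := Z a. Qed.

Lemma op_is_iso (a b : C) (f : hom a b) : is_iso f -> @is_iso op_cat b a f.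
Proof. by move=> [g [gf fg]]; exists g. Qed.

Lemma unop_is_iso (a b : C) (f : hom a b) : @is_iso op_cat b a f -> is_iso f.
Proof. by move=> [g [gf fg]]; exists g. Qed.

Lemma op_isomorphic (a b : C) : @isomorphic op_cat a b -> isomorphic a b.
Proof. by move=> [f /unop_is_iso fi]; apply: iso_sym; exists f. Qed.

Lemma op_short_exact (k m n : C) (i : hom k m) (p : hom m n) :
  @short_exact op_cat n m k p i <-> short_exact i p.
Proof. by split=> -[]. Qed.

End Opposite.

Section PreadditiveDual.
Variable C : preadditive_category.
Implicit Types a b c x k q : C.

Lemma cokernel_unique a b (f : hom a b) q (p : hom b q) q' (p' : hom b q') :
  is_cokernel f p -> is_cokernel f p' -> isomorphic q q'.
Proof.
by move=> K K'; apply: op_isomorphic; apply: (@kernel_unique (op_cat C)) K K'.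
Qed.

Lemma cokernel_epic_comp a b c (f : hom b c) (e : hom a b) q (p : hom c q) :
  epic e -> is_cokernel f p <-> is_cokernel (f ∘ e) p.
Proof. exact: (@kernel_monic_comp (op_cat C) c b a f e q p). Qed.

Lemma epic_cokernel_zero a b (f : hom a b) q (p : hom b q) :
  epic f -> is_cokernel f p -> is_zero q.
Proof.
by move=> ef K; apply/unop_is_zero/(@monic_kernel_zero (op_cat C) b a f q p).
Qed.

Lemma cokernel_zero_epic a b (f : hom a b) q (p : hom b q) :
  is_cokernel f p -> is_zero q -> epic f.
Proof.
by move=> K /op_is_zero; apply: (@kernel_zero_monic (op_cat C) b a f q p).
Qed.

Lemma epic_comp a b c (g : hom b c) (f : hom a b) :
  epic g -> epic f -> epic (g ∘ f).
Proof. by move=> mg mf x u v; rewrite !compmA => /mf/mg. Qed.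

End PreadditiveDual.

Lemma op_is_abelian (A : preadditive_category) :
  is_abelian A -> is_abelian (op_cat A).
Proof.
case=> z bi k c m e; split.
- by have [x /op_is_zero] := z; exists x.
- move=> a b; have [s [i1 [i2 [p1 [p2 [B1 B2 B3 B4 B5]]]]]] := bi a b.
  by exists s, p1, p2, i1, i2; split.
- by move=> a b f; apply: c.
- by move=> a b f; apply: k.
- by move=> a b f; apply: e.
- by move=> a b f; apply: m.
Qed.

Definition op_abelian (A : abelian_category) : abelian_category :=
  AbelianCategory (op_is_abelian (abelianP A)).

(** * Abelian categories *)

Section Abelian.
Variable A : abelian_category.
Implicit Types a b c x k q : A.

Lemma has_kernel a b (f : hom a b) : exists k (i : hom k a), is_kernel f i.
Proof. exact: (abelian_kernel (abelianP A)). Qed.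

Lemma has_cokernel a b (f : hom a b) : exists q (p : hom b q), is_cokernel f p.
Proof. exact: (abelian_cokernel (abelianP A)). Qed.

(** The monomorphism [f] is a kernel of some [g], and [g] factors through the cokernel [p]; hence a
    map killed by [p] is killed by [g] and lifts along [f]. *)
Lemma monic_is_kernel a b (f : hom a b) q (p : hom b q) :
  monic f -> is_cokernel f p -> is_kernel p f.
Proof.
move=> mf K; have [c [g Kg]] := abelian_monic (abelianP A) mf.
apply: kernelP => //; first exact: K.1.
move=> x u pu; apply: (kernel_lift Kg).
by have [g' <-] := cokernel_lift K Kg.1; rewrite -compmA pu compm0.
Qed.

Lemma monic_epic_iso a b (f : hom a b) : monic f -> epic f -> is_iso f.
Proof.
move=> mf ef; have [c [g Kg]] := abelian_monic (abelianP A) mf.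
(* As [f] is a kernel of [g] and epic, [g] vanishes, so the identity lifts along [f] and splits
   it. *)
have g0 : g = 0 by apply: (epic0 ef); apply: Kg.1.
have [|s fs] := kernel_lift (u := idm b) Kg; first by rewrite g0 comp0m.
exact: (split_epic_monic_iso mf fs).
Qed.

(* If [u] is killed by [m], then [m] factors through the cokernel [c] of [u];
   as [c ∘ p] is a cokernel of a map that [f] kills, [p] factors through
   [c ∘ p], so that [c] is split. *)
Lemma coimage_monic a b (f : hom a b) k (i : hom k a) q (p : hom a q) :
  is_kernel f i -> is_cokernel i p -> exists2 m : hom q b, monic m & m ∘ p = f.
Proof.
move=> Ki Kp; have [m mp] := cokernel_lift Kp Ki.1; exists m => //.
apply: monicP => x u mu; have [y [c Kc]] := has_cokernel u.
have [m' m'c] := cokernel_lift Kc mu.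
have ep := cokernel_epic Kp; have ecp := epic_comp (cokernel_epic Kc) ep.
have [z [h Kh]] := abelian_epic (abelianP A) ecp.
have [|h' ih'] := kernel_lift (u := h) Ki.
  by rewrite -mp -m'c -!compmA (compmA c) Kh.1 compm0.
have [|s scp] := cokernel_lift (u := p) Kh.
  by rewrite -ih' compmA Kp.1 comp0m.
have sc : s ∘ c = idm q by apply: ep; rewrite -compmA scp comp1m.
by rewrite -[u]comp1m -sc -compmA Kc.1 compm0.
Qed.

Lemma monic_short_exact k m n (i : hom k m) (p : hom m n) :
  monic i -> is_cokernel i p -> short_exact i p.
Proof. by move=> mi K; split=> //; apply: monic_is_kernel. Qed.

End Abelian.

Section AbelianDual.
Variable A : abelian_category.
Implicit Types a b c x k q : A.

Lemma epic_is_cokernel a b (f : hom a b) k (i : hom k a) :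
  epic f -> is_kernel f i -> is_cokernel i f.
Proof. exact: (@monic_is_kernel (op_abelian A) b a f k i). Qed.

End AbelianDual.

(** * Opposite functors and adjunctions *)

Section OppositeFunctor.
Variables C D : preadditive_category.

Definition op_functor (F : functor C D) : functor (op_cat C) (op_cat D) :=
  @Functor (op_cat C) (op_cat D) F (fun a b f => @fmap C D F b a f) (fmap1 F)
    (fun a b c g f => fmap_comp F f g).

(** A separate construction, since [op_cat (op_cat C)] is not convertible to [C] and a second
    [op_functor] would end in the double opposites. *)
Definition unop_functor (F : functor (op_cat C) (op_cat D)) : functor C D :=
  @Functor C D F (fun a b f => @fmap (op_cat C) (op_cat D) F b a f) (fmap1 F)
    (fun a b c g f => @fmap_comp (op_cat C) (op_cat D) F c b a f g).

Lemma op_additive (F : functor C D) :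
  additive_functor F -> additive_functor (op_functor F).
Proof. by move=> addF a b f g; apply: addF. Qed.

Lemma op_fully_faithful (F : functor C D) :
  fully_faithful F -> fully_faithful (op_functor F).
Proof. by move=> ffF a b; apply: ffF. Qed.

End OppositeFunctor.

Lemma op_adjoint (C D : preadditive_category) (L : functor C D)
    (R : functor D C) : adjoint L R -> adjoint (op_functor R) (op_functor L).
Proof.
move=> [eta [eps [T1 T2]]].
exists (@NatTrans (op_cat D) (op_cat D) (id_functor (op_cat D))
  (comp_functor (op_functor L) (op_functor R)) (fun d => eps d)
  (fun a b f => esym (nt_natural eps f))).
by exists (@NatTrans (op_cat C) (op_cat C)
  (comp_functor (op_functor R) (op_functor L)) (id_functor (op_cat C))
  (fun c => eta c) (fun a b f => esym (nt_natural eta f))).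
Qed.

Lemma unop_adjoint (C D : preadditive_category)
    (L : functor (op_cat C) (op_cat D)) (R : functor (op_cat D) (op_cat C)) :
  adjoint L R -> adjoint (unop_functor R) (unop_functor L).
Proof.
move=> [eta [eps [T1 T2]]].
exists (@NatTrans D D (id_functor D)
  (comp_functor (unop_functor L) (unop_functor R)) (fun d => eps d)
  (fun a b f => esym (@nt_natural (op_cat D) (op_cat D) _ _ eps b a f))).
by exists (@NatTrans C C
  (comp_functor (unop_functor R) (unop_functor L)) (id_functor C)
  (fun c => eta c)
  (fun a b f => esym (@nt_natural (op_cat C) (op_cat C) _ _ eta b a f))).
Qed.

Lemma op_exact (A D : preadditive_category) (Q : functor A D) :
  exact_functor Q -> exact_functor (op_functor Q).
Proof.
move=> [addQ exQ]; split; first exact: op_additive.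
move=> k m n i p /op_short_exact s; apply/op_short_exact; exact: exQ s.
Qed.

Section Functors.
Variables (C D : preadditive_category) (F : functor C D).

Lemma fmap_iso (a b : C) (f : hom a b) : is_iso f -> is_iso (fmap F f).
Proof.
by move=> [g [gf fg]]; exists (fmap F g); rewrite -!fmap_comp gf fg !fmap1.
Qed.

Lemma fmap0 (a b : C) : additive_functor F -> fmap F (0 : hom a b) = 0.
Proof. by move=> addF; apply: (addIr (fmap F 0)); rewrite -addF !add0r. Qed.

Lemma fmapN (a b : C) (f : hom a b) :
  additive_functor F -> fmap F (- f) = - fmap F f.
Proof.
by move=> addF; apply: (addIr (fmap F f)); rewrite -addF !addNr fmap0.
Qed.

Lemma fmapB (a b : C) (f g : hom a b) :
  additive_functor F -> fmap F (f - g) = fmap F f - fmap F g.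
Proof. by move=> addF; rewrite addF fmapN. Qed.

Lemma fobj_zero (a : C) : additive_functor F -> is_zero a -> is_zero (F a).
Proof.
by move=> addF Z; apply: is_zeroP; rewrite -fmap1 (zero_idm Z) fmap0.
Qed.

Lemma fmap_isomorphic (a b : C) : isomorphic a b -> isomorphic (F a) (F b).
Proof. by move=> [f fi]; exists (fmap F f); apply: fmap_iso. Qed.

End Functors.

(** * Adjunctions *)

Section Adjunction.
Variables (C D : preadditive_category) (L : functor C D) (R : functor D C).
Variables (eta : nat_trans (id_functor C) (comp_functor R L))
          (eps : nat_trans (comp_functor L R) (id_functor D)).
Hypothesis T1 : forall c : C, eps (L c) ∘ fmap L (eta c) = idm (L c).
Hypothesis T2 : forall d : D, fmap R (eps d) ∘ eta (R d) = idm (R d).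

Lemma unit_natural (a b : C) (f : hom a b) :
  eta b ∘ f = fmap R (fmap L f) ∘ eta a.
Proof. exact: (nt_natural eta f). Qed.

Lemma counit_natural (a b : D) (f : hom a b) :
  eps b ∘ fmap L (fmap R f) = f ∘ eps a.
Proof. exact: (nt_natural eps f). Qed.

Definition transpose (c : C) (d : D) (u : hom (L c) d) : hom c (R d) :=
  fmap R u ∘ eta c.

Definition untranspose (c : C) (d : D) (v : hom c (R d)) : hom (L c) d :=
  eps d ∘ fmap L v.

Lemma transposeK c d : cancel (@transpose c d) (@untranspose c d).
Proof.
move=> u; rewrite /untranspose /transpose fmap_comp compmA.
by rewrite counit_natural -compmA T1 compm1.
Qed.

Lemma untransposeK c d : cancel (@untranspose c d) (@transpose c d).
Proof.
move=> v; rewrite /untranspose /transpose fmap_comp -compmA.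
by rewrite -unit_natural compmA T2 comp1m.
Qed.

Lemma transpose_natural c d d' (w : hom d d') (u : hom (L c) d) :
  transpose (w ∘ u) = fmap R w ∘ transpose u.
Proof. by rewrite /transpose fmap_comp compmA. Qed.

Lemma untranspose_natural c d d' (w : hom d d') (v : hom c (R d)) :
  untranspose (fmap R w ∘ v) = w ∘ untranspose v.
Proof. by rewrite /untranspose fmap_comp compmA counit_natural compmA. Qed.

(** The injective map [untranspose] sends [fmap R f] to [f ∘ eps a], which is additive in [f], and
    it is itself additive because [L] is. *)
Lemma right_adjoint_additive : additive_functor L -> additive_functor R.
Proof.
move=> addL a b f g; apply: (can_inj (@untransposeK _ _)).
by rewrite /untranspose counit_natural addL compmDr !counit_natural compmDl.
Qed.

Lemma right_adjoint_kernel (a b : D) (f : hom a b) k (i : hom k a) :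
  additive_functor L -> is_kernel f i -> is_kernel (fmap R f) (fmap R i).
Proof.
move=> addL K; have addR := right_adjoint_additive addL.
apply: kernelP.
- move=> x u v /(congr1 (@untranspose _ _)).
  rewrite !untranspose_natural => /(kernel_monic K).
  exact: (can_inj (@untransposeK _ _)).
- by rewrite -fmap_comp K.1 fmap0.
- move=> x u fu; have [|v iv] := kernel_lift (u := untranspose u) K.
    by rewrite -untranspose_natural fu /untranspose fmap0 // compm0.
  by exists (transpose v); rewrite -transpose_natural iv untransposeK.
Qed.

(** The inverse is the map [t] with [fmap R t = eta (R d)]: one identity is [T1] after naturality of
    the counit, the other is [T2] after cancelling the faithful [R]. *)
Lemma ff_right_counit_iso : fully_faithful R -> forall d, is_iso (eps d).
Proof.
move=> ffR d; have [Rinv RK RinvK] := ffR d (L (R d)).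
have := RinvK (eta (R d)); set t := Rinv _ => Rt; exists t; split.
  by rewrite -counit_natural Rt T1.
apply: (bij_inj (ffR d d)).
by rewrite fmap_comp Rt T2 fmap1.
Qed.

(** By [T1] this map is a section of the isomorphism [eps (L c)]. For exact [L] it follows that the
    unit has its kernel and cokernel in the kernel of [L]. *)
Lemma ff_right_unit_iso : fully_faithful R -> forall c, is_iso (fmap L (eta c)).
Proof.
move=> ffR c; apply: (iso_compl (ff_right_counit_iso ffR (L c))).
by rewrite T1; apply: iso_idm.
Qed.

Lemma counit_iso_ff_right : (forall d, is_iso (eps d)) -> fully_faithful R.
Proof.
move=> ieps a b; have [e [ee' e'e]] := cid (ieps a).
exists (fun g => untranspose g ∘ e) => f.
  by rewrite /untranspose counit_natural -compmA e'e compm1.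
apply: (can_inj (@untransposeK _ _)).
by rewrite {1}/untranspose counit_natural -compmA ee' compm1.
Qed.

Lemma unit_iso_ff_left : (forall c, is_iso (eta c)) -> fully_faithful L.
Proof.
move=> ieta a b; have [e [ee' e'e]] := cid (ieta b).
exists (fun g => e ∘ transpose g) => f.
  by rewrite /transpose -unit_natural compmA ee' comp1m.
apply: (can_inj (@transposeK _ _)).
by rewrite {1}/transpose -unit_natural compmA e'e comp1m.
Qed.

End Adjunction.

(** Universal arrows [u c : c -> R (l c)] are chosen with [cid]. The action on maps and the counit
    are induced factorisations, and all laws come from their uniqueness [tU]. *)
Lemma has_left_adjoint (C D : preadditive_category) (R : functor D C) :
  (forall c, exists (l : D) (u : hom c (R l)), forall d (f : hom c (R d)),
     exists! g : hom l d, fmap R g ∘ u = f) ->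
  exists L, adjoint L R.
Proof.
move=> H.
pose l c := sval (cid (H c)).
pose u c : hom c (R (l c)) := sval (cid (svalP (cid (H c)))).
have up c d (f : hom c (R d)) : exists! g : hom (l c) d, fmap R g ∘ u c = f.
  exact: (svalP (cid (svalP (cid (H c))))).
pose t c d (f : hom c (R d)) := sval (cid (up c d f)).
have tP c d f : fmap R (t c d f) ∘ u c = f by case: (svalP (cid (up c d f))).
have tU c d (g g' : hom (l c) d) : fmap R g ∘ u c = fmap R g' ∘ u c -> g = g'.
  by move=> E; have [h [_ hU]] := up c d (fmap R g' ∘ u c);
    rewrite -(hU g E) -(hU g').
pose Lm a b (f : hom a b) := t _ _ (u b ∘ f).
have Lm1 a : Lm _ _ (idm a) = idm (l a).
  by apply: tU; rewrite tP fmap1 compm1 comp1m.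
have LmD a b c (g : hom b c) (f : hom a b) :
    Lm _ _ (g ∘ f) = Lm _ _ g ∘ Lm _ _ f.
  by apply: tU; rewrite tP fmap_comp -compmA tP !compmA tP.
pose L := @Functor C D l Lm Lm1 LmD.
have etaN a b (f : hom a b) : u b ∘ f = fmap R (Lm a b f) ∘ u a.
  by rewrite tP.
have epsN a b (f : hom a b) :
    t _ _ (idm (R b)) ∘ Lm _ _ (fmap R f) = f ∘ t _ _ (idm (R a)).
  apply: tU; rewrite !fmap_comp -!compmA !tP compm1.
  by rewrite compmA tP comp1m.
exists L, (@NatTrans C C (id_functor C) (comp_functor R L) u etaN).
exists (@NatTrans D D (comp_functor L R) (id_functor D)
  (fun d => t _ _ (idm (R d))) epsN); split=> [c|d] /=; last exact: tP.
by apply: tU; rewrite fmap_comp -compmA tP compmA tP fmap1.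
Qed.

Lemma has_right_adjoint (C D : preadditive_category) (L : functor C D) :
  (forall d, exists (r : C) (v : hom (L r) d), forall c (f : hom (L c) d),
     exists! g : hom c r, v ∘ fmap L g = f) ->
  exists R, adjoint L R.
Proof.
move=> H; have [|R /unop_adjoint adj] := @has_left_adjoint _ _ (op_functor L).
  exact: H.
exists (unop_functor R).
(* Eta for the record [functor]: the two sides become convertible once [L] is destructed. *)
have -> : L = unop_functor (op_functor L) by case: (L).
exact: adj.
Qed.

Section AdjointProperties.
Variables (C D : preadditive_category) (L : functor C D) (R : functor D C).
Hypothesis adj : adjoint L R.

Lemma adjoint_additive_right : additive_functor L -> additive_functor R.
Proof. by have [eta [eps [T1 T2]]] := adj; apply: right_adjoint_additive T2. Qed.

Lemma adjoint_kernel (a b : D) (f : hom a b) k (i : hom k a) :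
  additive_functor L -> is_kernel f i -> is_kernel (fmap R f) (fmap R i).
Proof. by have [eta [eps [T1 T2]]] := adj; exact: (right_adjoint_kernel T2). Qed.

End AdjointProperties.

Section AdjointPropertiesDual.
Variables (C D : preadditive_category) (L : functor C D) (R : functor D C).
Hypothesis adj : adjoint L R.

Lemma adjoint_additive_left : additive_functor R -> additive_functor L.
Proof.
move=> /op_additive addR a b f g.
exact: (adjoint_additive_right (op_adjoint adj) addR).
Qed.

Lemma adjoint_cokernel (a b : C) (f : hom a b) q (p : hom b q) :
  additive_functor R -> is_cokernel f p -> is_cokernel (fmap L f) (fmap L p).
Proof.
move=> /op_additive addR.
exact: (@adjoint_kernel _ _ _ _ (op_adjoint adj) b a f q p addR).
Qed.

End AdjointPropertiesDual.

(** [Q] preserves kernels as a right adjoint and cokernels as a left adjoint; the additivity of [L]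
    and [R] required for this is inherited from [Q]. *)
Lemma adjoint_triple_exact (A D : abelian_category) (Q : functor A D)
    (L R : functor D A) :
  additive_functor Q -> adjoint L Q -> adjoint Q R -> exact_functor Q.
Proof.
move=> addQ LQ QR; split=> // k m n i p [Ki Kp]; split.
  exact: (adjoint_kernel LQ (adjoint_additive_left LQ addQ) Ki).
exact: (adjoint_cokernel QR (adjoint_additive_right QR addQ) Kp).
Qed.

(* The inverse of [eta d : d -> Q (L d)] is [eps d] after [Q r], where
   [r : L d -> R d] is the transpose of the inverse of [eps d]. *)
Lemma adjoint_triple_ff_left (A D : preadditive_category) (Q : functor A D)
    (L R : functor D A) :
  adjoint L Q -> adjoint Q R -> fully_faithful R -> fully_faithful L.
Proof.
move=> LQ [eta [eps [T1 T2]]] ffR.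
have ieps := ff_right_counit_iso T1 T2 ffR.
have [etaL [epsL [S1 S2]]] := LQ.
(* A map [Q (L d) -> x] corresponds to a map [L d -> R x], hence to a map [d -> Q (R x)], and
   [Q (R x)] is isomorphic to [x]. *)
have inj d x (u v : hom (Q (L d)) x) : u ∘ etaL d = v ∘ etaL d -> u = v.
  rewrite -[u](transposeK T1) -[v](transposeK T1) /untranspose -!compmA.
  move=> /(iso_monic (ieps x)) E; congr (_ ∘ fmap Q _).
  exact: (can_inj (transposeK S1 (c := d) (d := R x)) E).
apply: (unit_iso_ff_left S1) => d; have [e [ee e'e]] := ieps d.
pose r := untranspose epsL (d := R d) e.
have Qr : fmap Q r ∘ etaL d = e by apply: (untransposeK S2).
have rd : (eps d ∘ fmap Q r) ∘ etaL d = idm d by rewrite -compmA Qr.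
exists (eps d ∘ fmap Q r); split=> //.
by apply: inj; rewrite -compmA rd compm1 comp1m.
Qed.

(** * Torsion theory and exact functors *)

Definition op_subcategory (C : preadditive_category) (Y : subcategory C) :
    subcategory (op_cat C) :=
  @Subcategory (op_cat C) Y
    (fun a b ab => subcategory_strict (op_isomorphic ab)).

Section Perp.
Variable A : abelian_category.
Implicit Types (Y : subcategory A).

Fact right_perp_strict Y (a b : A) : isomorphic a b ->
  (forall t : A, Y t -> forall u : hom t a, u = 0) ->
  (forall t : A, Y t -> forall u : hom t b, u = 0).
Proof.
move=> [f [g [gf fg]]] H t Yt u.
by rewrite -[u]comp1m -fg -compmA (H t Yt (g ∘ u)) compm0.
Qed.

Definition right_perp Y : subcategory A := Subcategory (@right_perp_strict Y).

Fact left_perp_strict Y (a b : A) : isomorphic a b ->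
  (forall t : A, Y t -> forall u : hom a t, u = 0) ->
  (forall t : A, Y t -> forall u : hom b t, u = 0).
Proof.
move=> [f [g [gf fg]]] H t Yt u.
by rewrite -[u]compm1 -fg compmA (H t Yt (u ∘ f)) comp0m.
Qed.

Definition left_perp Y : subcategory A := Subcategory (@left_perp_strict Y).

Lemma subcategory_ext Y Y' : (forall M, Y M <-> Y' M) -> Y = Y'.
Proof.
case: Y Y' => [p pP] [q qP] /= E.
have pq : p = q by apply: funext => M; apply/propext/E.
by rewrite pq in pP *; rewrite (Prop_irrelevance pP qP).
Qed.

Lemma coker_in_intro Y (a b : A) (f : hom a b) q (p : hom b q) :
  is_cokernel f p -> Y q -> coker_in Y f.
Proof.
move=> K Yk k' i' K'; apply: subcategory_strict Yk.
exact: cokernel_unique K K'.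
Qed.

End Perp.

Lemma unop_torsion_pair (A : abelian_category) (T F : subcategory A) :
  @torsion_pair (op_abelian A) (op_subcategory F) (op_subcategory T) ->
  torsion_pair T F.
Proof.
move=> [o s]; split=> [t f Tt Ff u|M]; first exact: (o f t).
have [f [t [p [i [Ff Tt /op_short_exact S]]]]] := s M.
by exists t, f, i, p.
Qed.

Lemma op_torsion_pair (A : abelian_category) (T F : subcategory A) :
  torsion_pair T F ->
  @torsion_pair (op_abelian A) (op_subcategory F) (op_subcategory T).
Proof.
move=> [o s]; split=> [t f Tt Ff u|M]; first exact: (o f t).
have [f [t [p [i [Ff Tt S]]]]] := s M.
by exists t, f, i, p; split=> //; apply/op_short_exact.
Qed.

Lemma unop_strongly_hereditary (A : abelian_category) (T F : subcategory A) :
  @strongly_hereditary (op_abelian A) (op_subcategory F) (op_subcategory T) ->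
  strongly_cohereditary T F.
Proof.
move=> [/unop_torsion_pair tp [L [phi H]]]; split=> //.
exists (unop_functor L).
exists (@NatTrans A A (unop_functor L) (id_functor A) (fun M => phi M)
  (fun a b f => esym (@nt_natural (op_cat A) (op_cat A) _ _ phi b a f))) => M.
have [H1 H2 H3 H4] := H M; split=> // K P N i p S FK.
by have [] := H4 N P K p i _ FK; first exact/op_short_exact.
Qed.

Lemma op_strongly_cohereditary (A : abelian_category) (T F : subcategory A) :
  strongly_cohereditary T F ->
  @strongly_hereditary (op_abelian A) (op_subcategory F) (op_subcategory T).
Proof.
move=> [/op_torsion_pair tp [L [phi H]]]; split=> //.
exists (op_functor L).
exists (@NatTrans (op_cat A) (op_cat A) (id_functor _) (op_functor L)
  (fun M => phi M) (fun a b f => esym (nt_natural phi f))) => M.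
have [H1 H2 H3 H4] := H M; split=> // K P N i p /op_short_exact S FK.
by have [] := H4 N P K p i S FK.
Qed.

(** [exact_functor] speaks of short exact sequences only. Factoring [f] as a monomorphism [m] after
    the cokernel [p] of [i] gives two of them: one makes [fmap Q i] a kernel of [fmap Q p], the
    other keeps [fmap Q m] monic. *)
Lemma exact_kernel (A D : abelian_category) (Q : functor A D) (a b : A)
    (f : hom a b) k (i : hom k a) :
  exact_functor Q -> is_kernel f i -> is_kernel (fmap Q f) (fmap Q i).
Proof.
move=> [addQ exQ] Ki; have [q [p Kp]] := has_cokernel i.
have [m mm mp] := coimage_monic Ki Kp; have [c [r Kr]] := has_cokernel m.
have [Qm _] := exQ _ _ _ _ _ (monic_short_exact mm Kr).
have [Qi _] := exQ _ _ _ _ _ (monic_short_exact (kernel_monic Ki) Kp).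
rewrite -mp fmap_comp.
exact: (iffLR (kernel_monic_comp _ _ (kernel_monic Qm)) Qi).
Qed.

Lemma exact_cokernel (A D : abelian_category) (Q : functor A D) (a b : A)
    (f : hom a b) q (p : hom b q) :
  exact_functor Q -> is_cokernel f p -> is_cokernel (fmap Q f) (fmap Q p).
Proof.
move=> /op_exact exQ.
exact: (@exact_kernel (op_abelian A) (op_abelian D) _ b a f q p exQ).
Qed.

Lemma kernel0_iso (C : preadditive_category) (a b k : C) (f : hom a b)
    (i : hom k a) : is_kernel f i -> f = 0 -> is_iso i.
Proof.
move=> K f0; have [|s fs] := kernel_lift (u := idm a) K.
  by rewrite f0 comp0m.
exact: (split_epic_monic_iso (kernel_monic K) fs).
Qed.

Lemma cokernel0_iso (C : preadditive_category) (a b q : C) (f : hom a b)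
    (p : hom b q) : is_cokernel f p -> f = 0 -> is_iso p.
Proof.
by move=> K f0; apply/unop_is_iso/(@kernel0_iso (op_cat C) b a q f p).
Qed.

Section ExactFunctor.
Variables (A D : abelian_category) (Q : functor A D) (Y : subcategory A).
Hypothesis exQ : exact_functor Q.
Hypothesis kerQ : forall M, Y M <-> functor_ker Q M.
Implicit Types a b M N : A.

Lemma exact_monic a b (f : hom a b) : monic f -> monic (fmap Q f).
Proof.
move=> mf; have [q [p Kp]] := has_cokernel f.
exact: kernel_monic (exact_kernel exQ (monic_is_kernel mf Kp)).
Qed.

Lemma exact_epic a b (f : hom a b) : epic f -> epic (fmap Q f).
Proof.
move=> mf; have [q [p Kp]] := has_kernel f.
exact: cokernel_epic (exact_cokernel exQ (epic_is_cokernel mf Kp)).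
Qed.

Lemma exact_iso_ker_in a b (f : hom a b) : is_iso (fmap Q f) -> ker_in Y f.
Proof.
move=> fi k i K; apply/kerQ.
exact: (monic_kernel_zero (iso_monic fi) (exact_kernel exQ K)).
Qed.

Lemma exact_iso_coker_in a b (f : hom a b) : is_iso (fmap Q f) -> coker_in Y f.
Proof.
move=> fi k i K; apply/kerQ.
exact: (epic_cokernel_zero (iso_epic fi) (exact_cokernel exQ K)).
Qed.

Lemma exact_iso a b (f : hom a b) :
  ker_in Y f -> coker_in Y f -> is_iso (fmap Q f).
Proof.
move=> kf cf; have [k [i Ki]] := has_kernel f; have [q [p Kp]] := has_cokernel f.
apply: monic_epic_iso.
  exact: (kernel_zero_monic (exact_kernel exQ Ki) (iffLR (kerQ k) (kf _ _ Ki))).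
exact: (cokernel_zero_epic (exact_cokernel exQ Kp) (iffLR (kerQ q) (cf _ _ Kp))).
Qed.

Lemma exact_kernel_serre : serre Y.
Proof.
have zQ (a : A) : is_zero a -> Y a by move=> /(fobj_zero exQ.1) /kerQ.
split=> //.
- move=> a b f mf /kerQ Zb; apply/kerQ/is_zeroP/(exact_monic mf).
  exact: etrans (zero_to _ Zb) (esym (zero_to _ Zb)).
- move=> a b f mf /kerQ Zb; apply/kerQ/is_zeroP/(exact_epic mf).
  exact: etrans (zero_from _ Zb) (esym (zero_from _ Zb)).
- move=> k m n i p s /kerQ Zk /kerQ Zn.
  have [Ki Kp] := exQ.2 _ _ _ _ _ s.
  have [|v iv] := kernel_lift (u := idm (Q m)) Ki; first exact: zero_to.
  by apply/kerQ/is_zeroP; rewrite -iv (zero_to v Zk) compm0.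
Qed.

Lemma monic_ker_in a b (f : hom a b) : monic f -> ker_in Y f.
Proof.
move=> mf k i K; have [z _ _ _] := exact_kernel_serre.
exact/z/(monic_kernel_zero mf K).
Qed.

(** Moves largeness to the target of [Q], where isomorphisms can be composed and cancelled. *)
Lemma large_sub_iso a b (f : hom a b) :
  monic f -> large_sub Y f <-> is_iso (fmap Q f).
Proof.
move=> mf; split=> [[_ cf]|fi]; first exact: (exact_iso (monic_ker_in mf)).
by split=> //; apply: exact_iso_coker_in.
Qed.

(** [K] is the intersection of the two subobjects, built as the kernel of [c ∘ t] for the cokernel
    [c] of [s]. As [Q] kills [c], it inverts the inclusion of [K] in [M2]. *)
Lemma large_sub_refine M M1 M2 (s : hom M1 M) (t : hom M2 M) :
  large_sub Y s -> large_sub Y t ->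
  exists (K : A) (a : hom K M1) (b : hom K M2),
    s ∘ a = t ∘ b /\ large_sub Y (s ∘ a).
Proof.
move=> ls lt; have [C [c Kc]] := has_cokernel s.
have [K [b Kb]] := has_kernel (c ∘ t).
have [|a ab] := kernel_lift (u := t ∘ b) (monic_is_kernel ls.1 Kc).
  by rewrite compmA Kb.1.
exists K, a, b; split=> //.
apply/large_sub_iso; rewrite ab; first exact: monic_comp lt.1 (kernel_monic Kb).
rewrite fmap_comp; apply: iso_comp; first exact/large_sub_iso/lt/(lt.1).
apply: (kernel0_iso (exact_kernel exQ Kb)); rewrite fmap_comp.
by rewrite (zero_to (fmap Q c)) ?comp0m //; apply/kerQ/(ls.2 _ _ Kc).
Qed.

End ExactFunctor.

Section ExactFunctorDual.
Variables (A D : abelian_category) (Q : functor A D) (Y : subcategory A).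
Hypothesis exQ : exact_functor Q.
Hypothesis kerQ : forall M, Y M <-> functor_ker Q M.
Implicit Types a b M N : A.

Let kerQ' (M : op_abelian A) :
  op_subcategory Y M <->
  @functor_ker (op_abelian A) (op_abelian D) (op_functor Q) M.
Proof. by split=> [/kerQ /op_is_zero|/unop_is_zero /kerQ]. Qed.

Lemma small_quot_iso a b (f : hom a b) :
  epic f -> small_quot Y f <-> is_iso (fmap Q f).
Proof.
move=> ef; have [H1 H2] := @large_sub_iso (op_abelian A) (op_abelian D) _
  (op_subcategory Y) (op_exact exQ) kerQ' b a f ef.
by split=> [/H1 /unop_is_iso|/op_is_iso /H2].
Qed.

Lemma small_quot_refine M M1 M2 (s : hom M M1) (t : hom M M2) :
  small_quot Y s -> small_quot Y t ->
  exists (K : A) (a : hom M1 K) (b : hom M2 K),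
    a ∘ s = b ∘ t /\ small_quot Y (a ∘ s).
Proof.
exact: (@large_sub_refine (op_abelian A) (op_abelian D) _ _ (op_exact exQ)
  kerQ').
Qed.

End ExactFunctorDual.

(** * Localisations and Gabriel quotients *)

Section Localisation.
Variables (A D : abelian_category) (Q : functor A D) (R : functor D A).
Variable Y : subcategory A.
Hypothesis exQ : exact_functor Q.
Hypothesis kerQ : forall M, Y M <-> functor_ker Q M.
Hypothesis QR : adjoint Q R.
Hypothesis ffR : fully_faithful R.

(** The torsion part of [M] is the kernel of the unit. The quotient embeds in [R (Q M)], and a map
    from an object of [Y] to [R (Q M)] corresponds to a map out of a zero object. *)
Lemma localisation_torsion_pair : torsion_pair Y (right_perp Y).
Proof.
split=> [t f Yt Yf u|M]; first exact: Yf.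
have [eta [eps [T1 T2]]] := QR; have ieta := ff_right_unit_iso T1 T2 ffR M.
have [k [i Ki]] := has_kernel (eta M); have [q [p Kp]] := has_cokernel i.
have [m mm mp] := coimage_monic Ki Kp.
exists k, q, i, p; split; first exact: (exact_iso_ker_in exQ kerQ ieta Ki).
  move=> t Yt u; apply: (monic0 mm).
  apply: (can_inj (untransposeK T2 (c := t) (d := Q M))).
  exact: etrans (zero_from _ (iffLR (kerQ t) Yt))
                (esym (zero_from _ (iffLR (kerQ t) Yt))).
exact: monic_short_exact (kernel_monic Ki) Kp.
Qed.

Lemma localisation_strongly_hereditary : strongly_hereditary Y (right_perp Y).
Proof.
split; first exact: localisation_torsion_pair.
have [eta [eps [T1 T2]]] := QR; exists (comp_functor R Q), eta => M.
have ieta := ff_right_unit_iso T1 T2 ffR M.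
split.
- exact: (exact_iso_ker_in exQ kerQ ieta).
- exact: (exact_iso_coker_in exQ kerQ ieta).
- move=> t Yt u; apply: (can_inj (untransposeK T2 (c := t) (d := Q M))).
  exact: etrans (zero_from _ (iffLR (kerQ t) Yt))
                (esym (zero_from _ (iffLR (kerQ t) Yt))).
- move=> K P N i p [Ki Kp] YN; split.
  + by move=> u v; apply: (cokernel_epic Kp).
  + move=> u; split=> [|[v <-]]; first exact: cokernel_lift Kp.
    by rewrite -compmA Kp.1 compm0.
  (* [Q N] is zero, so [fmap Q i] is invertible; the map from [Q K] corresponding to [w] extends
     along it, and the transpose of that extension extends [w]. *)
  + move=> w; have [e [ei ie]] : is_iso (fmap Q i).
      apply: (kernel0_iso (exact_kernel exQ Ki)).
      exact/zero_to/kerQ.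
    exists (transpose eta (untranspose eps w ∘ e)).
    rewrite /transpose -compmA unit_natural compmA -fmap_comp -compmA ei compm1.
    exact: (untransposeK T2).
Qed.

Lemma localisation_gabriel_quotient : gabriel_quotient Y Q.
Proof.
have [eta [eps [T1 T2]]] := QR; have ieps := ff_right_counit_iso T1 T2 ffR.
have ieta := ff_right_unit_iso T1 T2 ffR.
split=> //.
- by move=> M /kerQ.
- by move=> d; exists (R d), (eps d); apply: ieps.
(* The fraction for [g]: [e] is the quotient of [N] by the kernel of [eta N], [m] embeds it in
   [R (Q N)], [i] is the preimage of [m] under [f], and [s] is the restriction of [f] to this
   preimage. *)
- move=> M N g; pose f := transpose eta g.
  have [k [l Kl]] := has_kernel (eta N); have [I [e Ke]] := has_cokernel l.
  have [m mm me] := coimage_monic Kl Ke; have [C [c Kc]] := has_cokernel m.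
  have [K [i Ki]] := has_kernel (c ∘ f).
  have [|s ms] := kernel_lift (u := f ∘ i) (monic_is_kernel mm Kc).
    by rewrite compmA Ki.1.
  have iQe : is_iso (fmap Q e).
    apply: monic_epic_iso; last exact/(exact_epic exQ)/cokernel_epic/Ke.
    apply: (@monic_compr _ _ _ _ (fmap Q m)); rewrite -fmap_comp me.
    exact: iso_monic.
  have YC : Y C.
    apply: (exact_iso_coker_in exQ kerQ (ieta N)); rewrite -me.
    exact: (iffLR (cokernel_epic_comp m c (cokernel_epic Ke)) Kc).
  have iQi : is_iso (fmap Q i).
    apply: (kernel0_iso (exact_kernel exQ Ki)); rewrite fmap_comp.
    by rewrite (zero_to (fmap Q c)) ?comp0m //; apply/kerQ.
  have li : large_sub Y i by apply/(large_sub_iso exQ kerQ (kernel_monic Ki)).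
  have se : small_quot Y e.
    exact/(small_quot_iso exQ kerQ (cokernel_epic Ke)).
  exists (Fraction li se s); rewrite /represents /=.
  (* After composing with the monomorphism [fmap Q m], it remains to compare [fmap Q (eta N) ∘ g]
     with [fmap Q f]; both give [g] under the isomorphism [eps (Q N)]. *)
  apply: (exact_monic exQ mm); rewrite -(fmap_comp Q m s) ms fmap_comp !compmA.
  congr (_ ∘ _); rewrite -fmap_comp me; apply: (iso_monic (ieps (Q N))).
  by rewrite compmA T1 comp1m -[LHS](transposeK T1).
- move=> M N s t g hs; split=> [ht|].
  + have [K [a [a' [aa' la]]]] :=
      large_sub_refine exQ kerQ (frac_in_large s) (frac_in_large t).
    have [P [b [b' [bb' sb]]]] :=
      small_quot_refine exQ kerQ (frac_out_small s) (frac_out_small t).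
    (* On the common refinement the two maps agree only after [Q]. The cokernel [c] of their
       difference makes them equal, and [Q] inverts [c], so the enlarged quotient is still small. *)
    have [P' [c Kc]] := has_cokernel (b ∘ s ∘ a - b' ∘ t ∘ a').
    have iQc : is_iso (fmap Q c).
      apply: (cokernel0_iso (exact_cokernel exQ Kc)).
      rewrite fmapB; last exact: exQ.1.
      rewrite !fmap_comp -hs -ht !compmA -!fmap_comp bb' -!compmA -!fmap_comp.
      by rewrite aa' subrr.
    exists K, P', a, a', (c ∘ b), (c ∘ b'); split=> //.
    * by rewrite -!compmA bb'.
    * have ecb : epic (c ∘ b ∘ frac_out s).
        by rewrite -compmA; apply: epic_comp (cokernel_epic Kc) sb.1.
      apply/(small_quot_iso exQ kerQ ecb); rewrite -compmA fmap_comp.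
      exact/(iso_comp iQc)/(small_quot_iso exQ kerQ sb.1).
    * apply/eqP; rewrite -subr_eq0 -!compmA -compmBr !compmA; apply/eqP.
      exact: Kc.1.
  + move=> [K [P [a [a' [b [b' [aa' la bb' sb E]]]]]]].
    have sb' := sb; rewrite bb' in sb'; have la' := la; rewrite aa' in la'.
    (* By cancellation [Q] inverts [a'] and [b'], so the equation for [t] may be tested on the
       common refinement, where it is that for [s]. *)
    have iQa' : is_iso (fmap Q a').
      have := iffLR (large_sub_iso exQ kerQ la'.1) la'; rewrite fmap_comp.
      have lt := frac_in_large t.
      exact/iso_compl/(large_sub_iso exQ kerQ lt.1).
    have iQb' : is_iso (fmap Q b').
      have := iffLR (small_quot_iso exQ kerQ sb'.1) sb'; rewrite fmap_comp.
      have st := frac_out_small t.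
      exact/iso_compr/(small_quot_iso exQ kerQ st.1).
    apply: (iso_monic iQb'); apply: (iso_epic iQa').
    rewrite -!fmap_comp -E !fmap_comp -hs !compmA -!fmap_comp bb' -!compmA.
    by rewrite -!fmap_comp aa'.
Qed.

End Localisation.

(* An object of the form [R d] has no subobjects in [Y], so the fractions with
   target [R d] are maps from large subobjects to [R d]; by adjunction, the
   counit is therefore monic.  It is split epic on the image of [Q]. *)
Lemma gabriel_quotient_ff_right (A D : abelian_category) (Q : functor A D)
    (R : functor D A) (Y : subcategory A) :
  gabriel_quotient Y Q -> adjoint Q R ->
  fully_faithful R.
Proof.
move=> [exQ QY esQ frac eqv] [eta [eps [T1 T2]]].
apply: (counit_iso_ff_right T2) => d.
have [N [h [h' [h'h hh']]]] := esQ d.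
have sd : eps d ∘ (fmap Q (fmap R h ∘ eta N) ∘ h') = idm d.
  by rewrite fmap_comp !compmA counit_natural -(compmA h) T1 compm1.
apply: (split_epic_monic_iso _ sd); apply: monicP => x u eu.
have [M [f fi]] := esQ x; apply: (iso_epic fi); rewrite comp0m.
have [s sg] := frac M (R d) (u ∘ f).
have [eo ko] := frac_out_small s; have [mi ci] := frac_in_large s.
have [k [l Kl]] := has_kernel (frac_out s).
have l0 : l = 0.
  apply: (can_inj (untransposeK T2 (c := k) (d := d))).
  have Qk := QY _ (ko _ _ Kl).
  exact: etrans (zero_from _ Qk) (esym (zero_from _ Qk)).
have [o [oo _]] : is_iso (frac_out s).
  apply: monic_epic_iso => //; apply: monicP => y v.
  by move=> /(kernel_lift Kl)[w <-]; rewrite l0 comp0m.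
have [q [p Kp]] := has_cokernel (frac_in s).
apply: (cokernel_zero_epic (exact_cokernel exQ Kp) (QY _ (ci _ _ Kp))).
rewrite comp0m.
have os : fmap Q (o ∘ s) = u ∘ f ∘ fmap Q (frac_in s).
  by rewrite fmap_comp -sg !compmA -fmap_comp oo fmap1 comp1m.
suff s0 : o ∘ s = 0 by rewrite -os s0 fmap0 //; apply: exQ.1.
apply: (can_inj (untransposeK T2 (d := d))); rewrite /untranspose os.
by rewrite fmap0 ?compm0; [rewrite !compmA eu !comp0m|apply: exQ.1].
Qed.

(** If [Q M] is zero, the identity and the zero map of [M] represent the same map, hence are
    equivalent fractions: some large [a : K -> M] and small [b : M -> I] satisfy [b ∘ a = 0]. So [K]
    embeds in the kernel of [b], and [M] is an extension of two objects of [Y]. *)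
Lemma gabriel_quotient_kernel (A D : abelian_category) (Q : functor A D)
    (Y : subcategory A) :
  serre Y -> gabriel_quotient Y Q -> forall M, Y M <-> functor_ker Q M.
Proof.
move=> [Z S P E] [exQ QY esQ frac eqv] M; split=> [/QY //|QM].
have [id0 idM] : is_iso (idm M) /\ monic (idm M).
  by split; [|apply: iso_monic]; apply: iso_idm.
have lid : large_sub Y (idm M).
  split=> // q p Kp; apply: Z; apply: epic_cokernel_zero Kp.
  exact: iso_epic.
have sid : small_quot Y (idm M).
  split; first exact: iso_epic.
  by move=> k i Ki; apply: Z; apply: monic_kernel_zero Ki.
pose s f := Fraction lid sid f.
have H f : represents (s f) (0 : hom (Q M) (Q M)).
  by rewrite /represents compm0 comp0m (zero_to (fmap Q f)).
have [K [I [a [a' [b [b' [/= _ la _ sb]]]]]]] :=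
  iffLR (eqv _ _ (s (idm M)) (s 0) 0 (H _)) (H _).
rewrite !compm1 compm0 comp0m => ba0.
have {la}[ma ca] : large_sub Y a by rewrite -[a]comp1m.
have {sb}[eb kb] : small_quot Y b by rewrite -[b]compm1.
have [k [i Ki]] := has_kernel b; have [q [p Kp]] := has_cokernel a.
have [v iv] := kernel_lift Ki ba0.
apply: (E _ _ _ _ _ (monic_short_exact ma Kp)); last exact: ca Kp.
apply: (S _ _ v); last exact: kb Ki.
by apply: (@monic_compr _ _ _ _ i); rewrite iv.
Qed.

(** * Abelian full subcategories *)

Section FullSubcategory.
Variables (C : preadditive_category) (P : C -> Prop).

Definition full_sub : preadditive_category :=
  @PreadditiveCategory {x : C | P x} (fun a b => hom (sval a) (sval b))
    (fun a => idm (sval a)) (fun a b c g f => g ∘ f)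
    (fun a b c d h g f => compmA h g f) (fun a b f => comp1m f)
    (fun a b f => compm1 f) (fun a b c g g' f => compmDl g g' f)
    (fun a b c g f f' => compmDr g f f').

Definition full_incl : functor full_sub C :=
  @Functor full_sub C (fun a => sval a) (fun a b f => f) (fun a => erefl)
    (fun a b c g f => erefl).

Lemma full_incl_ff : fully_faithful full_incl.
Proof. by move=> a b; exists id. Qed.

Lemma full_sub_kernel (a b k : full_sub) (f : hom a b) (i : hom k a) :
  @is_kernel C (sval a) (sval b) f (sval k) i -> is_kernel f i.
Proof. by move=> [fi K]; split=> // x u; apply: K. Qed.

Lemma full_sub_cokernel (a b q : full_sub) (f : hom a b) (p : hom b q) :
  @is_cokernel C (sval a) (sval b) f (sval q) p -> is_cokernel f p.
Proof. by move=> [fi K]; split=> // x u; apply: K. Qed.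

(** The kernel taken in [C] is an object of the subcategory, so [f] can be cancelled in
    [f ∘ i = f ∘ 0] there. *)
Lemma full_sub_monic (a b : full_sub) (f : hom a b) (k : C)
    (i : hom k (sval a)) :
  @is_kernel C (sval a) (sval b) f k i -> P k -> monic f ->
  @monic C (sval a) (sval b) f.
Proof.
move=> Ki Pk mf; have i0 : i = 0.
  exact: (mf (exist _ k Pk) i 0 (etrans Ki.1 (esym (@compm0 C _ _ _ f)))).
by apply: monicP => x u /(kernel_lift Ki)[v <-]; rewrite i0 comp0m.
Qed.

Lemma full_sub_epic (a b : full_sub) (f : hom a b) (q : C)
    (p : hom (sval b) q) :
  @is_cokernel C (sval a) (sval b) f q p -> P q -> epic f ->
  @epic C (sval a) (sval b) f.
Proof.
move=> Kp Pq ef; have p0 : p = 0.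
  exact: (ef (exist _ q Pq) p 0 (etrans Kp.1 (esym (@comp0m C _ _ _ f)))).
by apply: epicP => x u /(cokernel_lift Kp)[v <-]; rewrite p0 compm0.
Qed.

End FullSubcategory.

Section Biproduct.
Variables (C : preadditive_category) (a b s : C).
Variables (i1 : hom a s) (i2 : hom b s) (p1 : hom s a) (p2 : hom s b).
Hypothesis bp : is_biproduct i1 i2 p1 p2.

Lemma biproduct_short_exact : short_exact i1 p2.
Proof.
have [E1 E2 E3 E4 E5] := bp; split.
  apply: kernelP => //.
    by move=> x u v /(congr1 (compm p1)); rewrite !compmA E1 !comp1m.
  move=> x u pu; exists (p1 ∘ u).
  by rewrite -[RHS]comp1m -E5 compmDl -!compmA pu compm0 addr0.
apply: cokernelP => //.
  by move=> x u v /(congr1 (fun w => w ∘ i2)); rewrite -!compmA E2 !compm1.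
move=> x u ui; exists (u ∘ i2).
by rewrite -[RHS]compm1 -E5 compmDr !compmA ui comp0m add0r.
Qed.

End Biproduct.

Section SerreAbelian.
Variables (A : abelian_category) (Y : subcategory A).
Hypothesis serreY : serre Y.

(** Kernels, cokernels and biproducts are those of [A]; a biproduct stays in [Y] as an extension of
    its summands. *)
Lemma serre_is_abelian : is_abelian (full_sub Y).
Proof.
have [Z S P E] := serreY; split.
- have [z zz] := abelian_zero (abelianP A).
  exists (exist _ z (Z z zz) : full_sub Y).
  by apply: is_zeroP; apply: (zero_idm zz).
- move=> [a Ya] [b Yb].
  have [s [i1 [i2 [p1 [p2 bp]]]]] := abelian_biproduct (abelianP A) a b.
  exists (exist _ s (E _ _ _ _ _ (biproduct_short_exact bp) Ya Yb)).
  by exists i1, i2, p1, p2.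
- move=> a b f; have [k [i Ki]] := @has_kernel A (sval a) (sval b) f.
  exists (exist _ k (S _ _ i (kernel_monic Ki) (svalP a))), i.
  exact: full_sub_kernel.
- move=> a b f; have [q [p Kp]] := @has_cokernel A (sval a) (sval b) f.
  exists (exist _ q (P _ _ p (cokernel_epic Kp) (svalP b))), p.
  exact: full_sub_cokernel.
- move=> a b f mf; have [k [i Ki]] := @has_kernel A (sval a) (sval b) f.
  have [q [p Kp]] := @has_cokernel A (sval a) (sval b) f.
  have Yk := S _ _ i (kernel_monic Ki) (svalP a).
  exists (exist _ q (P _ _ p (cokernel_epic Kp) (svalP b))), p.
  exact/full_sub_kernel/monic_is_kernel/Kp/(full_sub_monic Ki Yk mf).
- move=> a b f ef; have [k [i Ki]] := @has_kernel A (sval a) (sval b) f.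
  have [q [p Kp]] := @has_cokernel A (sval a) (sval b) f.
  have Yq := P _ _ p (cokernel_epic Kp) (svalP b).
  exists (exist _ k (S _ _ i (kernel_monic Ki) (svalP a))), i.
  exact/full_sub_cokernel/epic_is_cokernel/Ki/(full_sub_epic Kp Yq ef).
Qed.

Definition serre_abelian : abelian_category := AbelianCategory serre_is_abelian.

End SerreAbelian.

(** * Closed objects and the reflection onto them *)

Section Closed.
Variables (A : abelian_category) (Y : subcategory A).

Definition negligible (a b : A) (w : hom a b) : Prop :=
  ker_in Y w /\ coker_in Y w.

(** Gabriel's [Y]-closed objects, expressed by orthogonality to negligible maps instead of the
    vanishing of Hom and Ext from [Y]. *)
Definition closed (M : A) : Prop :=
  forall (a b : A) (w : hom a b), negligible w ->
  forall u : hom a M, exists! v : hom b M, v ∘ w = u.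

Definition coclosed (M : A) : Prop :=
  forall (a b : A) (w : hom a b), negligible w ->
  forall u : hom M b, exists! v : hom M a, w ∘ v = u.

Lemma closed_ext M (a b : A) (w : hom a b) (u : hom a M) :
  closed M -> negligible w -> exists v, v ∘ w = u.
Proof. by move=> cM nw; have [v [vw _]] := cM _ _ _ nw u; exists v. Qed.

Lemma closed_inj M (a b : A) (w : hom a b) (u v : hom b M) :
  closed M -> negligible w -> u ∘ w = v ∘ w -> u = v.
Proof.
move=> cM nw E; have [z [_ zU]] := cM _ _ _ nw (v ∘ w).
by rewrite -(zU u E) (zU v).
Qed.

Lemma closed_intro M :
  (forall (a b : A) (w : hom a b), negligible w ->
   forall u : hom a M, exists v, v ∘ w = u) ->
  (forall (a b : A) (w : hom a b), negligible w ->
   forall v : hom b M, v ∘ w = 0 -> v = 0) -> closed M.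
Proof.
move=> H1 H2 a b w nw u; have [v vw] := H1 _ _ _ nw u.
exists v; split=> // v' v'w.
apply/eqP; rewrite -subr_eq0; apply/eqP/(H2 _ _ _ nw).
by rewrite compmBl vw v'w subrr.
Qed.

(** A negligible map is an epimorphism [p] with kernel in [Y] followed by a monomorphism [m] with
    cokernel in [Y]. Maps to [M] descend along [p] because [M] is torsion-free, and extend along [m]
    by divisibility. *)
Lemma divisible_closed F M :
  torsion_pair Y F -> F M -> divisible Y M -> closed M.
Proof.
move=> [o _] FM dM; apply: closed_intro => a b w [kw cw].
all: have [k [i Ki]] := has_kernel w; have [q [p Kp]] := has_cokernel i.
all: have [m mm mp] := coimage_monic Ki Kp; have [c [r Kr]] := has_cokernel m.
all: have Yc : Y c by apply: (cw _ r); rewrite -mp;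
  apply: (iffLR (cokernel_epic_comp _ _ (cokernel_epic Kp))).
- move=> u; have [|u' u'p] := cokernel_lift (u := u) Kp.
    exact: (o _ _ (kw _ _ Ki) FM).
  have [_ _ /(_ u')[v vm]] := dM _ _ _ _ _ (monic_short_exact mm Kr) Yc.
  by exists v; rewrite -mp compmA vm.
- move=> v; rewrite -mp compmA => /(epic0 (cokernel_epic Kp)) vm.
  have [z <-] := cokernel_lift Kr vm.
  by rewrite (o _ _ Yc FM z) comp0m.
Qed.

Lemma negligible_iso_comp (a b c : A) (h : hom b c) (w : hom a b) :
  is_iso h -> negligible w -> negligible (h ∘ w).
Proof.
move=> ih [kw cw]; split=> [k i K|q p [phw K]].
  by apply: kw; apply/(kernel_monic_comp _ _ (iso_monic ih)); apply: K.
have [h' [h'h hh']] := ih.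
apply: (cw _ (p ∘ h)); split; first by rewrite -compmA.
move=> x u uw; have [|v [vp vU]] := K x (u ∘ h').
  by rewrite -compmA (compmA h') h'h comp1m.
exists v; split=> [|v' v'ph]; first by rewrite compmA vp -compmA h'h compm1.
by apply: vU; rewrite -v'ph -!compmA hh' compm1.
Qed.

Hypothesis serreY : serre Y.

Lemma negligible_monic (a b : A) (m : hom a b) :
  monic m -> coker_in Y m -> negligible m.
Proof.
move=> mm cm; split=> // k i K; have [Z _ _ _] := serreY.
exact/Z/(monic_kernel_zero mm K).
Qed.

Lemma closed_zero (z : A) : is_zero z -> closed z.
Proof.
move=> zz a b w nw u; exists 0; split=> [|v _].
  exact: etrans (zero_to _ zz) (esym (zero_to _ zz)).
exact/esym/zero_to.
Qed.

Lemma closed_biproduct (a b s : A) (i1 : hom a s) (i2 : hom b s)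
    (p1 : hom s a) (p2 : hom s b) :
  is_biproduct i1 i2 p1 p2 -> closed a -> closed b -> closed s.
Proof.
move=> [E1 E2 E3 E4 E5] ca cb; apply: closed_intro => x y w nw.
  move=> u; have [v1 H1] := closed_ext (p1 ∘ u) ca nw.
  have [v2 H2] := closed_ext (p2 ∘ u) cb nw; exists (i1 ∘ v1 + i2 ∘ v2).
  by rewrite compmDl -!compmA H1 H2 !compmA -compmDl E5 comp1m.
move=> v vw; rewrite -[v]comp1m -E5 compmDl -!compmA.
have -> : p1 ∘ v = 0.
  by apply: (closed_inj ca nw); rewrite -compmA vw compm0 comp0m.
have -> : p2 ∘ v = 0.
  by apply: (closed_inj cb nw); rewrite -compmA vw compm0 comp0m.
by rewrite !compm0 addr0.
Qed.

Lemma closed_kernel (a b : A) (f : hom a b) k (i : hom k a) :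
  is_kernel f i -> closed a -> closed b -> closed k.
Proof.
move=> K ca cb; apply: closed_intro => x y w nw.
  move=> u; have [v vw] := closed_ext (i ∘ u) ca nw.
  have [|v' iv'] := kernel_lift (u := v) K.
    apply: (closed_inj cb nw).
    by rewrite -compmA vw compmA K.1 !comp0m.
  exists v'; apply: (kernel_monic K); by rewrite compmA iv'.
move=> v vw; apply: (kernel_monic K); rewrite compm0.
by apply: (closed_inj ca nw); rewrite -compmA vw compm0 comp0m.
Qed.

Hypothesis reflection : forall M, exists (N : A) (phi : hom M N),
  closed N /\ negligible phi.

(** Kernels and biproducts are computed in [A], whereas a cokernel is the reflection [phi] of the
    cokernel in [A]. Normality of monomorphisms and epimorphisms then holds up to negligible maps,
    along which closed objects allow extension. *)
Lemma closed_is_abelian : is_abelian (full_sub closed).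
Proof.
have [Z S P E] := serreY; split.
- have [z zz] := abelian_zero (abelianP A).
  exists (exist _ z (closed_zero zz) : full_sub closed).
  by apply: is_zeroP; apply: (zero_idm zz).
- move=> [a Ya] [b Yb].
  have [s [i1 [i2 [p1 [p2 bp]]]]] := abelian_biproduct (abelianP A) a b.
  exists (exist _ s (closed_biproduct bp Ya Yb)).
  by exists i1, i2, p1, p2.
- move=> a b f; have [k [i Ki]] := @has_kernel A (sval a) (sval b) f.
  exists (exist _ k (closed_kernel Ki (svalP a) (svalP b))), i.
  exact: full_sub_kernel.
- move=> a b f; have [c [p Kp]] := @has_cokernel A (sval a) (sval b) f.
  have [q [phi [cq nphi]]] := reflection c.
  exists (exist _ q cq), (phi ∘ p); split.
    exact: etrans (esym (@compmA A _ _ _ _ phi p f))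
                  (etrans (congr1 _ Kp.1) (compm0 _ phi)).
  move=> x u uf; have [v vp] := cokernel_lift Kp uf.
  have [v' v'phi] := closed_ext v (svalP x) nphi.
  exists v'; split=> [|w wp]; first by rewrite /= compmA v'phi.
  apply: (closed_inj (svalP x) nphi); apply: (cokernel_epic Kp).
  by rewrite v'phi vp -wp -compmA.
- move=> a b f mf; have [k [i Ki]] := @has_kernel A (sval a) (sval b) f.
  have [c [p Kp]] := @has_cokernel A (sval a) (sval b) f.
  have ck := closed_kernel Ki (svalP a) (svalP b).
  have mf' := full_sub_monic Ki ck mf.
  have [q [phi [cq nphi]]] := reflection c.
  exists (exist _ q cq), (phi ∘ p); apply: kernelP.
  - by move=> x u v; apply: mf'.
  - exact: etrans (esym (@compmA A _ _ _ _ phi p f))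
                  (etrans (congr1 _ Kp.1) (compm0 _ phi)).
  - move=> x u pu; pose u' : hom (sval x) (sval b) := u.
    pose f' : hom (sval a) (sval b) := f.
    (* [p ∘ u] lands in the kernel of [phi], which lies in [Y], so the inclusion [j] of its kernel
       is negligible. Restricted to [l], [u] lifts along [f], and the lift extends along [j] since
       [a] is closed. *)
    have [l [j Kj]] := @has_kernel A (sval x) c (p ∘ u).
    have [I [e Ke]] := has_cokernel j.
    have [m mm me] := coimage_monic Kj Ke.
    have [k' [i' Ki']] := has_kernel phi.
    have [n i'n] : exists n, i' ∘ n = m.
      apply: (kernel_lift Ki'); apply: (cokernel_epic Ke).
      by rewrite -compmA me comp0m compmA.
    have nj : negligible j.
      apply: (negligible_monic (kernel_monic Kj)); apply: (coker_in_intro Ke).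
      apply: (S _ _ n); last exact: nphi.1 Ki'.
      by apply: (@monic_compr _ _ _ _ i'); rewrite i'n.
    have [v fv] : exists v : hom l (sval a), f' ∘ v = u' ∘ j.
      by apply: (kernel_lift (monic_is_kernel mf' Kp)); rewrite compmA Kj.1.
    have [w wj] := closed_ext v (svalP a) nj; exists w.
    apply: (closed_inj (svalP b) nj); rewrite -[RHS]fv -wj.
    exact/esym/(compmA f' w j).
- move=> a b f ef; have [k [i Ki]] := @has_kernel A (sval a) (sval b) f.
  have [c [p Kp]] := @has_cokernel A (sval a) (sval b) f.
  have [q [phi [cq nphi]]] := reflection c.
  have phi0 : phi = 0.
    apply: (cokernel_epic Kp); rewrite comp0m.
    apply: (@epic0 (full_sub closed) _ _ _ (exist _ q cq) _ ef).
    exact: etrans (esym (@compmA A _ _ _ _ phi p f))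
                  (etrans (congr1 _ Kp.1) (compm0 _ phi)).
  (* As [phi] is zero, [c] is its kernel; thus the cokernel of [f] in [A] lies in [Y], and the monic
     part [m] of [f] is negligible. *)
  have Yc : Y c.
    apply: (nphi.1 c (idm c)); rewrite phi0; apply: kernelP.
    - exact/iso_monic/iso_idm.
    - exact: comp0m.
    - by move=> x u _; exists u; rewrite comp1m.
  have [I [e Ke]] := has_cokernel i.
  have [m mm me] := coimage_monic Ki Ke.
  have nm : negligible m.
    apply: (negligible_monic mm); apply: (coker_in_intro _ Yc).
    by apply/(cokernel_epic_comp m p (cokernel_epic Ke)); rewrite me.
  exists (exist _ k (closed_kernel Ki (svalP a) (svalP b))), i.
  apply: cokernelP => //; first exact: Ki.1.
  move=> x u /(cokernel_lift Ke)[u' u'e].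
  have [v vm] := closed_ext u' (svalP x) nm; exists v.
  by rewrite -u'e -vm -compmA me.
Qed.

Definition closed_abelian : abelian_category := AbelianCategory closed_is_abelian.

End Closed.

(* Such a [Q] is the [j^*] of a recollement: the full faithfulness of [L] and
   the functors to and from [Y] come for free. *)
Definition localisation_kernel (A : abelian_category) (Y : subcategory A) :
    Prop :=
  exists (D : abelian_category) (Q : functor A D) (L R : functor D A),
    [/\ additive_functor Q, adjoint L Q, adjoint Q R, fully_faithful R &
        forall M, Y M <-> functor_ker Q M].

Lemma closed_localisation_kernel (A : abelian_category) (Y : subcategory A) :
  serre Y ->
  (forall M : A, exists (N : A) (phi : hom M N),
     closed Y N /\ negligible Y phi) ->
  (forall M : A, exists (N : A) (psi : hom N M),
     coclosed Y N /\ negligible Y psi) ->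
  localisation_kernel Y.
Proof.
move=> sY refl corefl; pose D := closed_abelian sY refl.
pose R : functor D A := full_incl (closed Y).
have [M|Q QR] := @has_left_adjoint A D R.
  have [N [phi [cN nphi]]] := refl M.
  by exists (exist _ N cN), phi => d f; apply: (svalP d).
have addR : additive_functor R by [].
have addQ := adjoint_additive_left QR addR.
have [eta [eps [T1 T2]]] := QR.
(* The unit is known only through the adjunction. Uniqueness of reflections gives [eta M = h ∘ phi],
   where [fmap R g] is inverse to [h]. *)
have neta (M : A) : negligible Y (eta M).
  have [N [phi [cN nphi]]] := refl M.
  pose N' : D := exist _ N cN.
  have [h hphi] := closed_ext (eta M) (svalP (Q M)) nphi.
  pose g : hom (Q M) N' := untranspose eps (phi : hom M (R N')).
  have geta : fmap R g ∘ eta M = phi.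
    exact: (untransposeK T2 (phi : hom M (R N'))).
  rewrite -hphi; apply: (negligible_iso_comp _ nphi).
  exists (fmap R g); split; first by apply: (closed_inj cN nphi);
    rewrite -compmA hphi geta comp1m.
  apply: (can_inj (transposeK T1 (c := M) (d := Q M))).
  rewrite /transpose.
  have := congr1 (compm h) geta; rewrite hphi => E.
  exact: etrans (esym (compmA h (fmap R g) (eta M))) (etrans E (esym (comp1m _))).
have kerQ M : Y M <-> functor_ker Q M.
  split=> [YM|QM].
    have [z zz] := abelian_zero (abelianP A).
    (* Its cokernel is [M], which lies in [Y]; a map from [M] to a closed object is thus determined
       by its restriction to the zero object [z]. *)
    have n0 : negligible Y (0 : hom z M).
      apply: (negligible_monic sY).
        by apply: monicP => x u _; apply: zero_to.
      apply: (coker_in_intro (p := idm M)) YM; apply: cokernelP.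
      - exact/iso_epic/iso_idm.
      - exact: compm0.
      - by move=> x u _; exists u; rewrite compm1.
    have eta0 : eta M = 0.
      by apply: (closed_inj (svalP (Q M)) n0); rewrite !compm0.
    apply: is_zeroP; apply: (can_inj (transposeK T1 (c := M) (d := Q M))).
    rewrite /transpose eta0.
    exact: etrans (compm0 _ _) (esym (compm0 _ _)).
  have eta0 : eta M = 0.
    have := congr1 (fun f => fmap R f ∘ eta M) (zero_idm QM).
    by rewrite fmap1 comp1m fmap0 // comp0m.
  apply: ((neta M).1 M (idm M)); rewrite eta0; apply: kernelP.
  - exact/iso_monic/iso_idm.
  - exact: comp0m.
  - by move=> x u _; exists u; rewrite comp1m.
have [d|L LQ] := @has_left_adjoint D A Q.
  have [N [psi [cN npsi]]] := corefl (R d).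
  (* [u] is the universal arrow: maps [R d -> R (Q M)] correspond to maps [N -> R (Q M)], because
     [R (Q M)] is closed and [psi] negligible, and these to maps [N -> M], because [N] is coclosed
     and [eta M] negligible. *)
  have [u upsi] := closed_ext (eta N) (svalP (Q N)) npsi.
  exists N, u => M f; pose f' : hom (R d) (R (Q M)) := f.
  have nat (h : hom N M) : (fmap R (fmap Q h) ∘ u) ∘ psi = eta M ∘ h.
    by rewrite -compmA upsi (unit_natural eta).
  have [g [etag gU]] := cN _ _ _ (neta M) (f' ∘ psi).
  exists g; split=> [|h hu].
    exact: (closed_inj (svalP (Q M)) npsi (etrans (nat g) etag)).
  by apply: gU; rewrite -nat; congr (_ ∘ _); apply: hu.
exists D, Q, L, R; split=> //; exact: full_incl_ff.
Qed.

(** * Torsion pairs and TTF-classes *)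

Section TorsionPairs.
Variable A : abelian_category.
Implicit Types T F X Y Z : subcategory A.

(** If [M] is right orthogonal to [T], the inclusion of its torsion part is zero and [M] is
    isomorphic to its torsion-free quotient. *)
Lemma torsion_pair_right_perp T F :
  torsion_pair T F -> forall M, F M <-> right_perp T M.
Proof.
move=> [o s] M; split=> [FM t Tt u|TM]; first exact: o Tt FM u.
have [t [f [i [p [Tt Ff [Ki Kp]]]]]] := s M.
apply: subcategory_strict Ff; apply: iso_sym; exists p.
exact/(cokernel0_iso Kp)/(TM t Tt).
Qed.

Lemma right_perp_monic T (a b : A) (f : hom a b) :
  monic f -> right_perp T b -> right_perp T a.
Proof. by move=> mf Tb t Tt u; apply: (monic0 mf); apply: Tb. Qed.

Lemma right_perp_extension T (k m n : A) (i : hom k m) (p : hom m n) :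
  short_exact i p -> right_perp T k -> right_perp T n -> right_perp T m.
Proof.
move=> [Ki Kp] Tk Tn t Tt u; have [v <-] := kernel_lift Ki (Tn t Tt (p ∘ u)).
by rewrite (Tk t Tt v) compm0.
Qed.

End TorsionPairs.

Section TorsionPairsDual.
Variable A : abelian_category.
Implicit Types T F X Y Z : subcategory A.

Lemma torsion_pair_left_perp T F :
  torsion_pair T F -> forall M, T M <-> left_perp F M.
Proof. by move=> /op_torsion_pair/torsion_pair_right_perp. Qed.

Lemma left_perp_epic T (a b : A) (f : hom a b) :
  epic f -> left_perp T a -> left_perp T b.
Proof. by move=> mf Tb t Tt u; apply: (epic0 mf); apply: Tb. Qed.

(** As a torsion-free class [Y] is closed under subobjects and extensions, as a torsion class under
    quotients. *)
Lemma ttf_class_serre Y : ttf_class Y -> serre Y.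
Proof.
move=> [X [Z [XY YZ]]].
have YX := torsion_pair_right_perp XY; have YZ' := torsion_pair_left_perp YZ.
split=> [z zz|a b f mf /YX Yb|a b f ef /YZ' Ya|k m n i p s /YX Yk /YX Yn].
- by apply/YX => t Xt u; apply: zero_to.
- exact/YX/(right_perp_monic mf Yb).
- exact/YZ'/(left_perp_epic ef Ya).
- exact/YX/(right_perp_extension s Yk Yn).
Qed.

Lemma strongly_hereditary_reflection Y Z : strongly_hereditary Y Z ->
  forall M : A, exists (N : A) (phi : hom M N), closed Y N /\ negligible Y phi.
Proof.
move=> [tp [L [phi H]]] M; have [kp cp FL dL] := H M.
exists (L M), (phi M); split=> //; exact: divisible_closed tp FL dL.
Qed.

End TorsionPairsDual.

Lemma strongly_cohereditary_coreflection (A : abelian_category)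
    (X Y : subcategory A) :
  strongly_cohereditary X Y ->
  forall M : A, exists (N : A) (psi : hom N M),
    coclosed Y N /\ negligible Y psi.
Proof.
move=> /op_strongly_cohereditary H M.
have [N [psi [cN [k c]]]] :=
  strongly_hereditary_reflection (A := op_abelian A) H M.
exists N, psi; split; last by split.
by move=> a b w [kw cw]; apply: (cN b a w).
Qed.

(** * Localisation kernels against TTF-triples, bilocalising subcategories and recollements *)

Section LocalisationKernel.
Variables (A : abelian_category) (Y : subcategory A).

Lemma strong_ttf_localisation_kernel X Z :
  strong_ttf X Y Z -> localisation_kernel Y.
Proof.
move=> [ttf cohered hered]; apply: closed_localisation_kernel.
- by apply: ttf_class_serre; exists X, Z.
- exact: strongly_hereditary_reflection hered.
- exact: strongly_cohereditary_coreflection cohered.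
Qed.

Lemma bilocalising_localisation_kernel :
  serre Y -> bilocalising Y -> localisation_kernel Y.
Proof.
move=> sY [D [Q [gQ [L LQ] [R QR]]]]; exists D, Q, L, R; split=> //.
- by have [[]] := gQ.
- exact: gabriel_quotient_ff_right gQ QR.
- exact: gabriel_quotient_kernel.
Qed.

Hypothesis lY : localisation_kernel Y.

Lemma localisation_kernel_serre : serre Y.
Proof.
have [D [Q [L [R [addQ LQ QR ffR kerQ]]]]] := lY.
exact: (exact_kernel_serre (adjoint_triple_exact addQ LQ QR) kerQ).
Qed.

Lemma localisation_kernel_bilocalising : bilocalising Y.
Proof.
have [D [Q [L [R [addQ LQ QR ffR kerQ]]]]] := lY.
exists D, Q; split; [|by exists L|by exists R].
exact: (localisation_gabriel_quotient (adjoint_triple_exact addQ LQ QR) kerQ QR).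
Qed.

(** The cohereditary half is the hereditary half in the opposite category, where [op_functor L] is
    the right adjoint of [op_functor Q]; [adjoint_triple_ff_left] supplies its full faithfulness. *)
Lemma localisation_kernel_strong_ttf :
  strong_ttf (left_perp Y) Y (right_perp Y).
Proof.
have [D [Q [L [R [addQ LQ QR ffR kerQ]]]]] := lY.
have exQ := adjoint_triple_exact addQ LQ QR.
have hered := localisation_strongly_hereditary exQ kerQ QR ffR.
have ffL := adjoint_triple_ff_left LQ QR ffR.
have kerQ' (M : op_abelian A) : op_subcategory Y M <->
    @functor_ker (op_abelian A) (op_abelian D) (op_functor Q) M.
  by split=> [/kerQ /op_is_zero|/unop_is_zero /kerQ].
have cohered : strongly_cohereditary (left_perp Y) Y.
  apply: unop_strongly_hereditary.
  exact: (@localisation_strongly_hereditary (op_abelian A) (op_abelian D) _ _ _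
    (op_exact exQ) kerQ' (op_adjoint LQ) (op_fully_faithful ffL)).
by split=> //; split; [apply: cohered.1|apply: hered.1].
Qed.

Lemma localisation_kernel_ttf_class : ttf_class Y.
Proof.
exists (left_perp Y), (right_perp Y).
by case: localisation_kernel_strong_ttf.
Qed.

(** Here [rec_B] is [Y] itself. The left adjoint of the inclusion takes the torsion-free quotient
    for the pair ending in [Y], the right adjoint the torsion part for the pair starting with
    [Y]. *)
Lemma localisation_kernel_recollement :
  exists R : recollement A, forall M, Y M <-> functor_ker (j_ustar R) M.
Proof.
have [[XY YZ] _ _] := localisation_kernel_strong_ttf.
have [D [Q [L [R [addQ LQ QR ffR kerQ]]]]] := lY.
pose B := serre_abelian localisation_kernel_serre.
pose i : functor B A := full_incl Y.
have [M|Il Ili] := @has_left_adjoint A B i.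
  have [t [f [j [p [Xt Yf [Kj Kp]]]]]] := XY.2 M.
  exists (exist _ f Yf), p => d g; apply: Kp.2; exact: XY.1 (svalP d) _.
have [M|Ir iIr] := @has_right_adjoint B A i.
  have [t [f [j [p [Xt Yf [Kj Kp]]]]]] := YZ.2 M.
  exists (exist _ t Xt), j => d g; apply: Kj.2; exact: YZ.1 (svalP d) Yf _.
have addi : additive_functor i by [].
have ffi : fully_faithful i by apply: full_incl_ff.
have im_ker M : ess_image i M <-> functor_ker Q M.
  split=> [[[N YN] iso]|/kerQ YM]; first exact/kerQ/(subcategory_strict iso).
  by exists (exist _ M YM), (idm M); apply: iso_idm.
by exists (Recollement (And3 addi (adjoint_additive_left Ili addi)
    (adjoint_additive_right iIr addi))
  (And3 addQ (adjoint_additive_left LQ addQ) (adjoint_additive_right QR addQ))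
  (conj LQ QR) (conj Ili iIr)
  (And3 ffi (adjoint_triple_ff_left LQ QR ffR) ffR) im_ker).
Qed.

End LocalisationKernel.

(** * Equivalences, and quotients with the same kernel *)

Lemma nat_iso_sym (C D : preadditive_category) (F G : functor C D) :
  nat_iso F G -> nat_iso G F.
Proof.
move=> [t it]; pose s c := sval (cid (it c)).
have st c : s c ∘ t c = idm (F c) by have [] := svalP (cid (it c)).
have ts c : t c ∘ s c = idm (G c) by have [] := svalP (cid (it c)).
have sN a b (f : hom a b) : s b ∘ fmap G f = fmap F f ∘ s a.
  apply: (iso_monic (it b)); rewrite !compmA ts comp1m nt_natural.
  by rewrite -compmA ts compm1.
by exists (NatTrans sN) => c; exists (t c).
Qed.

(** With no additivity at hand, [fmap F (idm c)] and [fmap F 0] are compared as maps into a zero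
    object, and naturality of [t] brings the equality back to [c]. *)
Lemma split_nat_iso_zero (C D : preadditive_category) (F : functor C D)
    (G : functor D C) (c : C) :
  nat_iso (comp_functor G F) (id_functor C) -> is_zero (F c) -> is_zero c.
Proof.
move=> [t it] Fc; apply: is_zeroP; apply: (iso_epic (it c)).
have FF : fmap F (idm c) = fmap F 0.
  exact: etrans (zero_to _ Fc) (esym (zero_to _ Fc)).
exact: etrans (esym (nt_natural t (idm c)))
  (etrans (congr1 (fun g => t c ∘ fmap G g) FF) (nt_natural t 0)).
Qed.

Lemma equivalence_zero (C D : preadditive_category) (F : functor C D) (c : C) :
  is_equivalence F -> is_zero (F c) <-> is_zero c.
Proof.
move=> [G [GF FG]]; split; first exact: split_nat_iso_zero GF.
move=> zc; apply: (split_nat_iso_zero FG); have [t it] := nat_iso_sym GF.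
by apply: (iso_zero _ zc); exists (t c); apply: it.
Qed.

Lemma nat_iso_zero (C D : preadditive_category) (F G : functor C D) (c : C) :
  nat_iso F G -> is_zero (F c) <-> is_zero (G c).
Proof.
move=> FG; split.
  by have [t it] := FG; apply: iso_zero; exists (t c); apply: it.
by have [t it] := nat_iso_sym FG; apply: iso_zero; exists (t c); apply: it.
Qed.

Section QuotientComparison.
Variables (A D D' : abelian_category).
Variables (Q : functor A D) (R : functor D A).
Variables (Q' : functor A D') (R' : functor D' A).
Hypotheses (exQ : exact_functor Q) (exQ' : exact_functor Q').
Hypotheses (QR : adjoint Q R) (ffR : fully_faithful R).
Hypotheses (Q'R' : adjoint Q' R') (ffR' : fully_faithful R').
Hypothesis kerQQ' : forall M, functor_ker Q M <-> functor_ker Q' M.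

(** The unit of [Q] and [R] has kernel and cokernel in the kernel of [Q], which is that of [Q'];
    hence [Q'] inverts it. *)
Lemma same_kernel_nat_iso :
  nat_iso (comp_functor (comp_functor Q' R) Q) Q'.
Proof.
have [eta [eps [T1 T2]]] := QR; apply: nat_iso_sym.
have N a b (f : hom a b) : fmap Q' (eta b) ∘ fmap Q' f =
    fmap (comp_functor (comp_functor Q' R) Q) f ∘ fmap Q' (eta a).
  by rewrite -!fmap_comp unit_natural.
exists (@NatTrans _ _ Q' (comp_functor (comp_functor Q' R) Q)
  (fun M => fmap Q' (eta M)) N) => M /=.
have ieta := ff_right_unit_iso T1 T2 ffR M.
pose Y : subcategory A := Subcategory (fun a b ab =>
  @iso_zero D (Q a) (Q b) (fmap_isomorphic Q ab)).
have kerQ N' : Y N' <-> functor_ker Q N' by [].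
apply: (exact_iso exQ' kerQQ' (Y := Y)).
  exact: (exact_iso_ker_in exQ kerQ).
exact: (exact_iso_coker_in exQ kerQ).
Qed.

(** The composite [Q' R Q R'] is isomorphic to [Q' R'] by the preceding lemma, and then to the
    identity by the counit. *)
Lemma same_kernel_inverse :
  nat_iso (comp_functor (comp_functor Q' R) (comp_functor Q R'))
    (id_functor D').
Proof.
have [t it] := same_kernel_nat_iso.
have [eta [eps [T1 T2]]] := Q'R'; have ieps := ff_right_counit_iso T1 T2 ffR'.
have N a b (f : hom a b) : (eps b ∘ t (R' b)) ∘
    fmap (comp_functor (comp_functor Q' R) (comp_functor Q R')) f =
    f ∘ (eps a ∘ t (R' a)).
  rewrite -compmA (nt_natural t (fmap R' f)) !compmA; congr (_ ∘ _).
  exact: counit_natural.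
exists (@NatTrans _ _ _ (id_functor D') _ N) => d.
exact: (iso_comp (ieps d) (it _)).
Qed.

End QuotientComparison.

Lemma adjoint_left_zero (C D : preadditive_category) (L : functor C D)
    (R : functor D C) (c : C) :
  additive_functor R -> adjoint L R ->
  is_zero (L c) <-> forall d (u : hom c (R d)), u = 0.
Proof.
move=> addR [eta [eps [T1 T2]]]; split=> [zL d u|H].
  apply: (can_inj (untransposeK T2 (c := c) (d := d))).
  exact: etrans (zero_from _ zL) (esym (zero_from _ zL)).
apply: is_zeroP; apply: (can_inj (transposeK T1 (c := c) (d := L c))).
exact: etrans (H _ _) (esym (H _ _)).
Qed.

Lemma adjoint_right_zero (C D : preadditive_category) (L : functor C D)
    (R : functor D C) (d : D) :
  additive_functor L -> adjoint L R ->
  is_zero (R d) <-> forall c (u : hom (L c) d), u = 0.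
Proof.
move=> addL /op_adjoint adj.
have H := @adjoint_left_zero (op_cat D) (op_cat C) (op_functor R)
  (op_functor L) d (op_additive addL) adj.
by split=> [/op_is_zero/H|/H/unop_is_zero].
Qed.

(** * Recollements *)

Section Recollements.
Variable A : abelian_category.
Implicit Types R : recollement A.

Definition recollement_kernel R : subcategory A :=
  Subcategory (fun a b ab => @iso_zero (rec_C R) (j_ustar R a) (j_ustar R b)
    (fmap_isomorphic (j_ustar R) ab)).

Lemma j_ustar_exact R : exact_functor (j_ustar R).
Proof.
have [addj _ _] := rec_additive_j R; have [Lj jR] := rec_adjoint_j R.
exact: adjoint_triple_exact Lj jR.
Qed.

Lemma kernel_of_recollement R : localisation_kernel (recollement_kernel R).
Proof.
have [addj _ _] := rec_additive_j R; have [Lj jR] := rec_adjoint_j R.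
have [_ _ ffR] := rec_fully_faithful R.
by exists (rec_C R), (j_ustar R), (j_lshriek R), (j_lstar R).
Qed.

Lemma equivalent_recollementsP R R' : equivalent_recollements R R' <->
  recollement_kernel R = recollement_kernel R'.
Proof.
split=> [[_ [Theta [eqT isoT]]]|E].
  apply: subcategory_ext => M; apply: (iff_trans _ (nat_iso_zero M isoT)).
  exact: iff_sym (equivalence_zero (j_ustar R M) eqT).
have ker M : functor_ker (j_ustar R) M <-> functor_ker (j_ustar R') M.
  by rewrite -[functor_ker (j_ustar R) M]/(recollement_kernel R M) E.
have ker' M := iff_sym (ker M).
have [_ jR] := rec_adjoint_j R; have [_ _ ffR] := rec_fully_faithful R.
have [_ jR'] := rec_adjoint_j R'; have [_ _ ffR'] := rec_fully_faithful R'.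
have exj := j_ustar_exact R; have exj' := j_ustar_exact R'.
split.
  have N (a b : A) (f : hom a b) : idm b ∘ f = f ∘ idm a.
    by rewrite comp1m compm1.
  have isoid : nat_iso (comp_functor (id_functor A) (id_functor A))
      (id_functor A).
    exists (@NatTrans A A (comp_functor (id_functor A) (id_functor A))
      (id_functor A) (fun a => idm a) N) => a.
    exact: iso_idm.
  by exists (id_functor A).
exists (comp_functor (j_ustar R') (j_lstar R)); split.
  (* The quasi-inverse has the same form with the two recollements exchanged. *)
  exists (comp_functor (j_ustar R) (j_lstar R')); split.
    exact: same_kernel_inverse.
  exact: same_kernel_inverse.
have [t it] := same_kernel_nat_iso exj exj' jR ffR ker.
by exists (@NatTrans _ _ _ (comp_functor (j_ustar R') (id_functor A)) t
  (fun a b f => nt_natural t f)).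
Qed.

(** By adjunction [i_ustar R] kills [M] exactly when [M] has no nonzero map to the image of
    [i_lstar R], which is the kernel of [j_ustar R]. *)
Lemma recollement_X R M :
  left_perp (recollement_kernel R) M <-> functor_ker (i_ustar R) M.
Proof.
have [addi _ _] := rec_additive_i R; have [Ii _] := rec_adjoint_i R.
apply: iff_trans (iff_sym (adjoint_left_zero M addi Ii)).
split=> [H d u|H t /(rec_im_ker R)[b [f [g [gf fg]]]] u].
  apply: H; apply/(rec_im_ker R); exists d, (idm _); exact: iso_idm.
by rewrite -[u]comp1m -fg -compmA (H b (g ∘ u)) compm0.
Qed.

Lemma recollement_Z R M :
  right_perp (recollement_kernel R) M <-> functor_ker (i_ushriek R) M.
Proof.
have [addi _ _] := rec_additive_i R; have [_ Ii] := rec_adjoint_i R.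
apply: iff_trans (iff_sym (adjoint_right_zero M addi Ii)).
split=> [H d u|H t /(rec_im_ker R)[b [f [g [gf fg]]]] u].
  apply: H; apply/(rec_im_ker R); exists d, (idm _); exact: iso_idm.
by rewrite -[u]compm1 -fg compmA (H b (u ∘ f)) comp0m.
Qed.

(** A representative is chosen; [equivalent_recollementsP] makes the result independent of it. *)
Definition class_kernel (c : recollement_class A) : subcategory A :=
  recollement_kernel (sval (cid (recollement_classP c))).

Lemma class_kernelE R :
  class_kernel (class_of_recollement R) = recollement_kernel R.
Proof.
rewrite /class_kernel; case: cid => R' /= E.
by apply/equivalent_recollementsP; rewrite -E; apply/equivalent_recollementsP.
Qed.

Lemma class_kernel_inj : injective class_kernel.
Proof.
move=> c c'; rewrite /class_kernel.
case: cid => R /= cR; case: cid => R' /= cR' E.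
case: c c' cR cR' => [p pP] [q qP] /= pE qE.
have pq : p = q.
  rewrite pE qE; apply: funext => S; apply: propext.
  by split=> /equivalent_recollementsP H; apply/equivalent_recollementsP;
    rewrite -H E.
by rewrite {pE qE} pq in pP *; rewrite (Prop_irrelevance pP qP).
Qed.

Lemma class_kernel_localisation c : localisation_kernel (class_kernel c).
Proof. exact: kernel_of_recollement. Qed.

Lemma localisation_class_kernel Y :
  localisation_kernel Y -> exists c, class_kernel c = Y.
Proof.
move=> /localisation_kernel_recollement[R YR].
exists (class_of_recollement R); rewrite class_kernelE.
by apply: subcategory_ext => M; apply: iff_sym.
Qed.

(** The outer terms of a TTF-triple are the left and right orthogonals of its middle term. *)
Lemma ttf_Y_inj : injective (@ttf_Y A).
Proof.
move=> [X Y Z P] [X' Y' Z' P'] /= E; rewrite -{Y'}E in P' *.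
have XX' : X = X'.
  have [[tp _] _ _] := P; have [[tp' _] _ _] := P'.
  apply: subcategory_ext => M; apply: (iff_trans (torsion_pair_left_perp tp M)).
  exact: iff_sym (torsion_pair_left_perp tp' M).
have ZZ' : Z = Z'.
  have [[_ tp] _ _] := P; have [[_ tp'] _ _] := P'.
  apply: subcategory_ext => M; apply: (iff_trans (torsion_pair_right_perp tp M)).
  exact: iff_sym (torsion_pair_right_perp tp' M).
by rewrite -{}XX' -{}ZZ' in P' *; rewrite (Prop_irrelevance P P').
Qed.

Lemma bttf_Y_inj : injective (@bttf_Y A).
Proof.
move=> [Y P] [Y' P'] /= E; rewrite -{Y'}E in P' *.
by rewrite (Prop_irrelevance P P').
Qed.

Lemma bserre_Y_inj : injective (@bserre_Y A).
Proof.
move=> [Y P] [Y' P'] /= E; rewrite -{Y'}E in P' *.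
by rewrite (Prop_irrelevance P P').
Qed.

End Recollements.

(** * The bijections *)

(** Both injections have image [K]; [f x] is a chosen preimage of [p x] under [q], and the inverse
    is chosen symmetrically. *)
Lemma bijection_of_same_image (S T U : Type) (K : U -> Prop) (p : S -> U)
    (q : T -> U) :
  injective p -> injective q ->
  (forall x, K (p x)) -> (forall y, K (q y)) ->
  (forall u, K u -> exists x, p x = u) ->
  (forall u, K u -> exists y, q y = u) ->
  exists f : S -> T, bijective f /\ forall x, q (f x) = p x.
Proof.
move=> pI qI Kp Kq Sp Sq.
pose f x := sval (cid (Sq (p x) (Kp x))).
pose g y := sval (cid (Sp (q y) (Kq y))).
have qf x : q (f x) = p x by exact: svalP (cid (Sq (p x) (Kp x))).
have pg y : p (g y) = q y by exact: svalP (cid (Sp (q y) (Kq y))).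
exists f; split=> //; exists g => [x|y]; first by apply: pI; rewrite pg qf.
by apply: qI; rewrite qf pg.
Qed.

Theorem theorem4p3 (A : abelian_category) :
  exists (f : recollement_class A -> strong_ttf_triple A)
         (g : strong_ttf_triple A -> bilocalising_ttf_class A)
         (h : bilocalising_ttf_class A -> bilocalising_serre A),
    [/\ bijective f, bijective g & bijective h] /\
    [/\ forall (R : recollement A) (M : A),
          [/\ ttf_X (f (class_of_recollement R)) M <-> functor_ker (i_ustar R) M,
              ttf_Y (f (class_of_recollement R)) M <-> ess_image (i_lstar R) M &
              ttf_Z (f (class_of_recollement R)) M <-> functor_ker (i_ushriek R) M],
        forall t : strong_ttf_triple A, bttf_Y (g t) = ttf_Y t &
        forall Y : bilocalising_ttf_class A, bserre_Y (h Y) = bttf_Y Y].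
Proof.
have K2 (t : strong_ttf_triple A) : localisation_kernel (ttf_Y t).
  exact: strong_ttf_localisation_kernel (strong_ttf_tripleP t).
have K3 (Y : bilocalising_ttf_class A) : localisation_kernel Y.
  have [ttfY bY] := bttfP Y.
  exact: bilocalising_localisation_kernel (ttf_class_serre ttfY) bY.
have K4 (Y : bilocalising_serre A) : localisation_kernel Y.
  by have [sY bY] := bserreP Y; apply: bilocalising_localisation_kernel.
have S2 Y : localisation_kernel Y -> exists t : strong_ttf_triple A, ttf_Y t = Y.
  by move=> /localisation_kernel_strong_ttf H; exists (StrongTTFTriple H).
have S3 Y : localisation_kernel Y ->
    exists Y' : bilocalising_ttf_class A, bttf_Y Y' = Y.
  move=> lY; have H := conj (localisation_kernel_ttf_class lY)
    (localisation_kernel_bilocalising lY).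
  by exists (BilocalisingTTFClass H).
have S4 Y : localisation_kernel Y ->
    exists Y' : bilocalising_serre A, bserre_Y Y' = Y.
  move=> lY; have H := conj (localisation_kernel_serre lY)
    (localisation_kernel_bilocalising lY).
  by exists (BilocalisingSerre H).
have [f [bf fE]] := bijection_of_same_image (@class_kernel_inj A) (@ttf_Y_inj A)
  (@class_kernel_localisation A) K2 (@localisation_class_kernel A) S2.
have [g [bg gE]] := bijection_of_same_image (@ttf_Y_inj A) (@bttf_Y_inj A)
  K2 K3 S2 S3.
have [h [bh hE]] := bijection_of_same_image (@bttf_Y_inj A) (@bserre_Y_inj A)
  K3 K4 S3 S4.
exists f, g, h; split=> //; split=> // R M.
(* The middle term of the image triple is the kernel of [j_ustar R], so the outer terms are its
   orthogonals, which [recollement_X] and [recollement_Z] identify. *)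
have Y := fE (class_of_recollement R); rewrite class_kernelE in Y.
have [[tp tp'] _ _] := strong_ttf_tripleP (f (class_of_recollement R)).
rewrite Y in tp tp' *; split.
- exact: iff_trans (torsion_pair_left_perp tp M) (recollement_X R M).
- exact: iff_sym (rec_im_ker R M).
- exact: iff_trans (torsion_pair_right_perp tp' M) (recollement_Z R M).
Qed.
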